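(* Let $k$ be a field and let $G$ be a connected finite simple graph with at least one edge. If $G$ is $(C_4,C_5)$-free, then $\mathrm{reg}(G^{\Pi})=\mathrm{im}(G^{\Pi})$ for any edge-clique partition $\Pi$ of $G$.
   Context: All graphs are finite, undirected and simple. $C_n$ denotes the cycle on $n$ vertices, and $G$ is $(C_4,C_5)$-free if no induced subgraph of $G$ is isomorphic to $C_4$ or to $C_5$. Let $G=(V,E)$ be connected with $E\neq\emptyset$, and let $\Pi=\{W_1,\dots,W_k\}$ be a family of cliques of $G$ (vertex subsets inducing complete graphs), each having at least $2$ vertices (here the integer $k$ is unrelated to the field). $\Pi$ is an edge-clique partition of $G$ if $\{E(G[W_1]),\dots,E(G[W_k])\}$ is a partition of $E$, where $G[W]$ is the subgraph induced on $W$. The edge-clique-whisker $G^{\Pi}$ is the graph with vertex set $V\cup\{x_1,\dots,x_k\}$ (with $x_1,\dots,x_k$ distinct new vertices) and edge set $E\cup\{ux_i: u\in W_i,\ 1\leq i\leq k\}$. For a graph $H$ with vertices $u_1,\dots,u_n$, the edge ideal $I(H)\subseteq R=k[x_1,\dots,x_n]$ (with $k$ the field) is generated by the monomials $x_ix_j$ with $u_iu_j\in E(H)$, and $\mathrm{reg}(H):=\mathrm{reg}(R/I(H))=\max\{j-i:\beta_{i,j}\neq 0\}$ is the Castelnuovo-Mumford regularity, where $\beta_{i,j}$ are the graded Betti numbers of $R/I(H)$ as an $R$-module. A matching is a set of edges no two of which share an end; a matching $M$ is induced if the only edges of $H$ between endpoints of edges in $M$ are those of $M$. $\mathrm{im}(H)$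 is the maximum cardinality of an induced matching of $H$. *)

(* Defs.v *)
From HB Require Import structures.
From mathcomp Require Import all_boot all_order all_algebra.
From mathcomp Require Import mpoly.

Set Implicit Arguments.
Unset Strict Implicit.
Unset Printing Implicit Defensive.

Import Order.TTheory GRing.Theory Num.Theory.

Local Open Scope ring_scope.

(** * Finite simple graphs *)

Record sgraph := SGraph {
  svertex :> finType;
  sedge : rel svertex;
  sedge_sym : ssrbool.symmetric sedge;
  sedge_irr : irreflexive sedge
}.

Definition connected (G : sgraph) : Prop :=
  forall x y : G, connect (@sedge G) x y.

Definition edges (G : sgraph) : {set {set G}} :=
  [set A | [exists x, exists y, sedge x y && (A == [set x; y])]].

(** [E(G[W])], the edges being kept as subsets of the vertex set of [G]. *)
Definition edges_in (G : sgraph) (W : {set G}) : {set {set G}} :=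
  [set A in edges G | A \subset W].

Section Induced.
Variables (G : sgraph) (S : {set G}).

Definition induced_rel : rel {x : G | x \in S} :=
  fun x y => sedge (val x) (val y).

Lemma induced_sym : ssrbool.symmetric induced_rel.
Proof. by move=> x y; exact: sedge_sym. Qed.

Lemma induced_irr : irreflexive induced_rel.
Proof. by move=> x; exact: sedge_irr. Qed.

Definition induced : sgraph := SGraph induced_sym induced_irr.
End Induced.

Definition isomorphic (G H : sgraph) : Prop :=
  exists2 f : G -> H, bijective f &
    forall x y : G, sedge (f x) (f y) = sedge x y.

Section CycleGraph.
Variable n : nat.

Definition cycle_rel : rel 'I_n := fun i j =>
  (i != j) && ((j == i.+1 %% n :> nat)%N || (i == j.+1 %% n :> nat)%N).

Lemma cycle_sym : ssrbool.symmetric cycle_rel.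
Proof. by move=> i j; rewrite /cycle_rel eq_sym orbC. Qed.

Lemma cycle_irr : irreflexive cycle_rel.
Proof. by move=> i; rewrite /cycle_rel eqxx. Qed.

(** The cycle [C_n]; meaningful for [n >= 3]. *)
Definition cycle_graph : sgraph := SGraph cycle_sym cycle_irr.
End CycleGraph.

Definition graph_free (H G : sgraph) : Prop :=
  ~ exists S : {set G}, isomorphic (induced S) H.

Definition clique (G : sgraph) (W : {set G}) : Prop :=
  {in W &, forall x y, x != y -> sedge x y}.

(** * Edge-clique partitions and whiskers *)

(** Cliques with at least two vertices are determined by their edges, so no
    multiplicity is lost by forming the set of the [E(G[W])], [W \in Pi]. *)
Definition edge_clique_partition (G : sgraph) (Pi : {set {set G}}) : Prop :=
  (forall W, W \in Pi -> clique W /\ (2 <= #|W|)%N) /\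
  partition [set edges_in W | W in Pi] (edges G).

Section Whisker.
Variables (G : sgraph) (Pi : {set {set G}}).

(** The new vertices are indexed by the members of [Pi]. *)
Definition whisker_rel : rel (G + {W : {set G} | W \in Pi})%type :=
  fun a b =>
    match a, b with
    | inl u, inl v => sedge u v
    | inl u, inr W => u \in val W
    | inr W, inl v => v \in val W
    | inr _, inr _ => false
    end.

Lemma whisker_sym : ssrbool.symmetric whisker_rel.
Proof. by move=> [u|W] [v|W'] //=; exact: sedge_sym. Qed.

Lemma whisker_irr : irreflexive whisker_rel.
Proof. by move=> [u|W] //=; exact: sedge_irr. Qed.

Definition whisker : sgraph := SGraph whisker_sym whisker_irr.
End Whisker.

(** * Induced matchings *)

Definition induced_matching (H : sgraph) (M : {set {set H}}) : bool :=
  [&& M \subset edges H, trivIset M & edges_in (cover M) \subset M].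

Definition im (H : sgraph) : nat :=
  (\max_(M : {set {set H}} | induced_matching M) #|M|)%N.

(** * Graded Betti numbers and Castelnuovo-Mumford regularity *)

Section Regularity.
Variables (K : fieldType) (n : nat).
Local Notation R := {mpoly K[n]}.

(** A sequence of graded free modules [F_i = \bigoplus_a R(- shift i a)],
    written as row vectors, with maps [v |-> v *m diff i : F_(i+1) -> F_i] and
    an augmentation [F_0 -> R/I], given by representatives in [R] of the images
    of the basis vectors.  Natural shifts are enough, since [R/I] lives in
    nonnegative degrees. *)
Record graded_free_seq := GradedFreeSeq {
  rk : nat -> nat;
  shift : forall i, 'I_(rk i) -> nat;
  diff : forall i, 'M[R]_(rk i.+1, rk i);
  aug : 'cV[R]_(rk 0)
}.

(** The maps preserve degrees: a nonzero entry in row [a] and column [b] of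
    [diff i] is homogeneous of degree [shift a - shift b]. *)
Definition graded_maps (F : graded_free_seq) : Prop :=
  (forall b, aug F b 0 \is (shift b).-homog) /\
  (forall i a b m, m \in msupp (diff F i a b) ->
     (mdeg m + shift b = shift a)%N).

Definition resolves (I : R -> Prop) (F : graded_free_seq) : Prop :=
  [/\ forall f : R, exists v : 'rV_(rk F 0), I (f - (v *m aug F) 0 0),
      forall v : 'rV_(rk F 0),
        I ((v *m aug F) 0 0) <-> exists w, v = w *m diff F 0 &
      forall i (v : 'rV_(rk F i.+1)),
        v *m diff F i = 0 <-> exists w, v = w *m diff F i.+1].

(** [diff i] maps [F_(i+1)] into [(x_1, ..., x_n) F_i]. *)
Definition minimal (F : graded_free_seq) : Prop :=
  forall i a b, (diff F i a b)@_0%MM = 0.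

Definition minimal_graded_free_resolution (I : R -> Prop)
    (F : graded_free_seq) : Prop :=
  [/\ graded_maps F, resolves I F & minimal F].

Definition betti (F : graded_free_seq) (i j : nat) : nat :=
  #|[set a : 'I_(rk F i) | shift a == j]|.

(** [is_reg I r] means [reg (R/I) = r], for a homogeneous ideal [I].  Minimal
    graded free resolutions are unique up to graded isomorphism, so the choice
    of [F] is immaterial. *)
Definition is_reg (I : R -> Prop) (r : int) : Prop :=
  exists F : graded_free_seq,
    [/\ minimal_graded_free_resolution I F,
        exists i j, betti F i j != 0%N /\ j%:Z - i%:Z = r &
        forall i j, betti F i j != 0%N -> j%:Z - i%:Z <= r].
End Regularity.

(** The variable attached to the vertex [u] is ['X_(enum_rank u)]. *)
Definition edge_ideal (K : fieldType) (H : sgraph) (f : {mpoly K[#|H|]}) :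
    Prop :=
  exists c : H -> H -> {mpoly K[#|H|]},
    f = \sum_(u : H) \sum_(v : H | sedge u v)
          c u v * ('X_(enum_rank u) * 'X_(enum_rank v)).

Definition graph_reg (K : fieldType) (H : sgraph) (r : int) : Prop :=
  is_reg (@edge_ideal K H) r.

(* Main.v *)
(** Let [H] be the whisker graph.  A vertex [v] of [G] in a clique [W] of [Pi]
    has the new neighbour [x_W], and [N[x_W]] is contained in [N[v]].  So
    adding the edge [v x_W] to an induced matching of [H - N[v]] gives one of
    [H], while reg(H) <= max(reg(H - v), reg(H - N[v]) + 1).  Both smaller graphs
    inherit the property that every edge of [G] still present lies in a clique
    of [Pi] whose new vertex is still present.  Induction gives reg <= im.

    All ideals met on the way are generated by the edges of [H] and a set of
    variables, and the inequality is realised by explicit resolutions: the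
    horseshoe lemma, followed by the cancellation of redundant generators.

    For reg >= im, let [T] be the Koszul resolution of the ideal of a maximum
    induced matching [M], and [F] a minimal resolution of the edge ideal.  There
    is a map from [T] to [F], and, after the variables outside [M] are set to
    zero, a map back; the composition is the identity in every degree.  Hence the
    generator of [T] in homological degree [#|M|] and internal degree [2 #|M|]
    forces one of [F] in the same degrees. *)

Require Import Defs.
From mathcomp Require Import all_boot all_order all_algebra.
From mathcomp Require Import mpoly zify.
From Stdlib Require Import Classical.

Set Implicit Arguments.
Unset Strict Implicit.
Unset Printing Implicit Defensive.

Import Order.TTheory GRing.Theory.

Local Open Scope ring_scope.

(** * Restriction of polynomials to sets of monomials *)

Section MonomialRestriction.
Variables (K : fieldType) (n : nat).
Local Notation R := {mpoly K[n]}.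
Implicit Types (f g : R) (P Q : pred 'X_{1..n}) (m : 'X_{1..n}).

Definition mres P f : R := \sum_(m <- msupp f | P m) f@_m *: 'X_[m].

Lemma mcoeff_mres P f m : (mres P f)@_m = if P m then f@_m else 0.
Proof.
rewrite /mres raddf_sum /=; under eq_bigr => i _ do rewrite mcoeffZ mcoeffX.
have [mf|mf] := boolP (m \in msupp f); last first.
  rewrite (memN_msupp_eq0 mf) if_same big_seq_cond big1 // => i /andP[i_f _].
  by case: eqP mf => [<-|]; rewrite ?i_f ?mulr0.
rewrite big_mkcond (bigD1_seq m) ?msupp_uniq //= eqxx mulr1 big1 ?addr0 //.
by move=> i /negPf->; rewrite mulr0 if_same.
Qed.

Lemma msupp_mres P f m : (m \in msupp (mres P f)) = P m && (m \in msupp f).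
Proof. by rewrite !mcoeff_msupp mcoeff_mres; case: (P m); rewrite ?eqxx. Qed.

Lemma mresD P f g : mres P (f + g) = mres P f + mres P g.
Proof.
apply/mpolyP=> m; rewrite mcoeffD !mcoeff_mres mcoeffD.
by case: (P m); rewrite ?addr0.
Qed.

Lemma mres0 P : mres P 0 = 0.
Proof. by apply/mpolyP=> m; rewrite mcoeff_mres mcoeff0 if_same. Qed.

Lemma mres_sum P I (r : seq I) (F : I -> R) :
  mres P (\sum_(i <- r) F i) = \sum_(i <- r) mres P (F i).
Proof. by apply: big_morph; [exact: mresD | exact: mres0]. Qed.

Lemma mres_id P f : {in msupp f, forall m, P m} -> mres P f = f.
Proof.
move=> Pf; apply/mpolyP=> m; rewrite mcoeff_mres; case: ifPn => // nPm.
by apply/esym/memN_msupp_eq0; apply: contra nPm => /Pf.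
Qed.

Lemma mres_eq0 P f : {in msupp f, forall m, ~~ P m} -> mres P f = 0.
Proof.
move=> Pf; apply/mpolyP=> m; rewrite mcoeff_mres mcoeff0; case: ifP => // Pm.
by apply/memN_msupp_eq0/negP=> /Pf; rewrite Pm.
Qed.

Lemma mres_split P f : f = mres P f + mres (predC P) f.
Proof.
apply/mpolyP=> m; rewrite mcoeffD !mcoeff_mres /=.
by case: (P m); rewrite ?addr0 ?add0r.
Qed.

(** When every monomial of [g] turns [Q] into [P], the factor [f] alone decides which terms survive.
    For homogeneous [g] this makes homogeneous components commute with multiplication by [g]. *)
Lemma mresM P Q f g :
  (forall m1 m2, m2 \in msupp g -> P (m1 + m2)%MM = Q m1) ->
  mres P (f * g) = mres Q f * g.
Proof.
move=> PQ; apply/mpolyP=> m; rewrite mcoeff_mres !mcoeffM.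
case: ifP => Pm; last apply/esym/big1.
  apply: eq_bigr => k /eqP mk; rewrite mcoeff_mres.
  have [k2|/memN_msupp_eq0->] := boolP (bmnm k.2 \in msupp g); last by rewrite !mulr0.
  by rewrite -(PQ _ _ k2) -mk Pm.
move=> k /eqP mk; rewrite mcoeff_mres.
have [k2|/memN_msupp_eq0->] := boolP (bmnm k.2 \in msupp g); last by rewrite !mulr0.
by rewrite -(PQ _ _ k2) -mk Pm mul0r.
Qed.

Lemma mem_msuppM f g m : m \in msupp (f * g) ->
  exists m1 m2, [/\ m1 \in msupp f, m2 \in msupp g & m = (m1 + m2)%MM].
Proof.
by move/msuppM_le/allpairsP=> [[m1 m2]] /= [? ? ->]; exists m1, m2.
Qed.

Lemma mem_msupp_sum I (r : seq I) (F : I -> R) m :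
  m \in msupp (\sum_(i <- r) F i) -> exists i, m \in msupp (F i).
Proof.
move=> mF; apply: NNPP => nF; move: mF; rewrite mcoeff_msupp raddf_sum /=.
rewrite big1 ?eqxx // => i _; apply/memN_msupp_eq0/negP => mi.
by apply: nF; exists i.
Qed.

(* [mres (supp_in C)] sets the variables outside [C] to zero. *)
Definition supp_in (C : {set 'I_n}) : pred 'X_{1..n} :=
  fun m => [forall i, (i \notin C) ==> (m i == 0%N)].

Lemma supp_inD C m1 m2 :
  supp_in C (m1 + m2)%MM = supp_in C m1 && supp_in C m2.
Proof.
apply/forallP/andP => [h|[/forallP h1 /forallP h2] i].
  split; apply/forallP=> i; have := h i; rewrite mnmDE addn_eq0;
  by case: (i \in C) => //= /andP[].
by move: (h1 i) (h2 i); rewrite mnmDE addn_eq0; case: (i \in C) => //= -> ->.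
Qed.

Lemma supp_in0 C : supp_in C 0%MM.
Proof. by apply/forallP=> i; rewrite mnmE eqxx implybT. Qed.

Lemma mres_supp_inM C f g :
  mres (supp_in C) (f * g) = mres (supp_in C) f * mres (supp_in C) g.
Proof.
rewrite {1}(mres_split (supp_in C) g) mulrDr mresD.
rewrite (@mresM _ (supp_in C)); last first.
  by move=> m1 m2; rewrite msupp_mres supp_inD => /andP[-> _]; rewrite andbT.
rewrite [X in _ + X]mres_eq0 ?addr0 // => m /mem_msuppM[m1 [m2 [_]]].
by rewrite msupp_mres => /andP[/= /negPf h _ ->]; rewrite supp_inD h andbF.
Qed.

(** * Monomial ideals as up-closed sets of monomials *)

Definition mono (A : pred 'X_{1..n}) f : Prop := {in msupp f, forall m, A m}.

Definition up_closed (A : pred 'X_{1..n}) : Prop :=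
  forall m1 m2, A m1 -> A (m1 + m2)%MM.

Lemma mono0 A : mono A 0.
Proof. by move=> m; rewrite msupp0. Qed.

Lemma monoD A f g : mono A f -> mono A g -> mono A (f + g).
Proof.
move=> Af Ag m /msuppD_le; rewrite mem_cat => /orP[]; [exact: Af|exact: Ag].
Qed.

Lemma monoM A f g : up_closed A -> mono A g -> mono A (f * g).
Proof.
move=> upA Ag m /mem_msuppM[m1 [m2 [_ /Ag h ->]]].
by rewrite addmC; apply: upA.
Qed.

Lemma mono_mres A P f : mono A f -> mono A (mres P f).
Proof. by move=> Af m; rewrite msupp_mres => /andP[_ /Af]. Qed.

Lemma monoMX A q f : mono A (f * 'X_[q]) <-> mono (fun m => A (m + q)%MM) f.
Proof.
split=> h m.
  by move=> mf /=; apply: h; rewrite addmC mcoeff_msupp mcoeffMX -mcoeff_msupp.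
by rewrite (perm_mem (msuppMX f q)) => /mapP[m' /h ? ->]; rewrite addmC.
Qed.

(** [B] describes the ideal generated by [A] and ['X_[q]]: the terms of [f] divisible by ['X_[q]]
    form a multiple of it, and the other terms must lie in [A]. *)
Lemma mono_colon A B q f : up_closed A ->
  (forall m, B m = A m || (q <= m)%MM) ->
  mono B f <-> exists c, mono A (f - c * 'X_[q]).
Proof.
move=> upA AB; split=> [Bf|[c Ac]]; last first.
  rewrite -(subrK (c * 'X_[q]) f); apply: monoD => m.
    by move/Ac; rewrite AB => ->.
  rewrite (perm_mem (msuppMX c q)) => /mapP[m' _ ->].
  by rewrite AB lem_addr orbT.
pose D := fun m => (q <= m)%MM.
exists (\sum_(m <- msupp f | D m) f@_m *: 'X_[(m - q)%MM]).
have -> : (\sum_(m <- msupp f | D m) f@_m *: 'X_[(m - q)%MM]) * 'X_[q] = mres D f.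
  by rewrite mulr_suml; apply: eq_bigr => m Dm; rewrite -scalerAl -mpolyXD submK.
rewrite {1}(mres_split D f) addrC addKr => m.
by rewrite msupp_mres => /andP[/= /negPf nD /Bf]; rewrite AB -/(D m) nD orbF.
Qed.

Lemma mcoeff0M f g : (f * g)@_0%MM = f@_0%MM * g@_0%MM.
Proof. by rewrite rmorphM. Qed.

End MonomialRestriction.

(** * Bounded resolutions of graded submodules of free modules *)

Section BoundedResolutions.
Variables (K : fieldType) (n : nat).
Local Notation R := {mpoly K[n]}.

(* A homogeneous map of degree 0 between graded free modules whose basis
   vectors have the degrees [s' a] and [s b]. *)
Definition hmx p q (s' : 'I_p -> nat) (s : 'I_q -> nat) (D : 'M[R]_(p, q)) :=
  forall a b m, m \in msupp (D a b) -> (mdeg m + s b = s' a)%N.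

Lemma hmxM p q r (s1 : 'I_p -> nat) (s2 : 'I_q -> nat) (s3 : 'I_r -> nat)
    (A : 'M[R]_(p, q)) (B : 'M[R]_(q, r)) :
  hmx s1 s2 A -> hmx s2 s3 B -> hmx s1 s3 (A *m B).
Proof.
move=> hA hB a b m; rewrite mxE => /mem_msupp_sum[j].
case/mem_msuppM=> m1 [m2 [/hA h1 /hB h2 ->]].
by rewrite mdegD -addnA h2 h1.
Qed.

Lemma hmxD p q (s' : 'I_p -> nat) (s : 'I_q -> nat) (A B : 'M[R]_(p, q)) :
  hmx s' s A -> hmx s' s B -> hmx s' s (A + B).
Proof.
move=> hA hB a b m; rewrite mxE => /msuppD_le; rewrite mem_cat.
by case/orP=> [/hA|/hB].
Qed.

Lemma hmxN p q (s' : 'I_p -> nat) (s : 'I_q -> nat) (A : 'M[R]_(p, q)) :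
  hmx s' s A -> hmx s' s (- A).
Proof. by move=> hA a b m; rewrite mxE (perm_mem (msuppN _)) => /hA. Qed.

Lemma hmxB p q (s' : 'I_p -> nat) (s : 'I_q -> nat) (A B : 'M[R]_(p, q)) :
  hmx s' s A -> hmx s' s B -> hmx s' s (A - B).
Proof. by move=> hA hB; apply: hmxD => //; apply: hmxN. Qed.

Lemma hmxZ p q (s' : 'I_p -> nat) (s : 'I_q -> nat) (c : K) (A : 'M[R]_(p, q)) :
  hmx s' s A -> hmx s' s (c%:MP *: A).
Proof.
move=> hA a b m; rewrite mxE mul_mpolyC => /msuppZ_le; exact: hA.
Qed.

Lemma hmx0 p q (s' : 'I_p -> nat) (s : 'I_q -> nat) : hmx s' s 0.
Proof. by move=> a b m; rewrite mxE msupp0. Qed.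

Lemma hmx_natr p q (s' : 'I_p -> nat) (s : 'I_q -> nat) (A : 'M[R]_(p, q)) :
  (forall a b, A a b = 0 \/ A a b = 1 /\ s b = s' a) -> hmx s' s A.
Proof.
move=> hA a b m; have [->|[-> <-]] := hA a b; first by rewrite msupp0.
by rewrite msupp1 inE => /eqP->; rewrite mdeg0.
Qed.

Lemma hmx1 q (s : 'I_q -> nat) : hmx s s 1%:M.
Proof.
by apply: hmx_natr => a b; rewrite mxE; case: eqP => [->|_]; [right|left].
Qed.

Definition scat q1 q2 (s1 : 'I_q1 -> nat) (s2 : 'I_q2 -> nat) :
    'I_(q1 + q2) -> nat :=
  fun j => match split j with inl a => s1 a | inr b => s2 b end.

Lemma scat_lshift q1 q2 (s1 : 'I_q1 -> nat) (s2 : 'I_q2 -> nat) j :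
  scat s1 s2 (lshift q2 j) = s1 j.
Proof. by rewrite /scat (unsplitK (inl j)). Qed.

Lemma scat_rshift q1 q2 (s1 : 'I_q1 -> nat) (s2 : 'I_q2 -> nat) j :
  scat s1 s2 (rshift q1 j) = s2 j.
Proof. by rewrite /scat (unsplitK (inr j)). Qed.

Lemma hmx_row p q1 q2 (s' : 'I_p -> nat) (s1 : 'I_q1 -> nat) (s2 : 'I_q2 -> nat)
    (A : 'M[R]_(p, q1)) (B : 'M[R]_(p, q2)) :
  hmx s' s1 A -> hmx s' s2 B -> hmx s' (scat s1 s2) (row_mx A B).
Proof.
move=> hA hB a b m; case: (split_ordP b) => j ->.
  by rewrite row_mxEl scat_lshift; apply: hA.
by rewrite row_mxEr scat_rshift; apply: hB.
Qed.

Lemma hmx_col p1 p2 q (s1 : 'I_p1 -> nat) (s2 : 'I_p2 -> nat) (s : 'I_q -> nat)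
    (A : 'M[R]_(p1, q)) (B : 'M[R]_(p2, q)) :
  hmx s1 s A -> hmx s2 s B -> hmx (scat s1 s2) s (col_mx A B).
Proof.
move=> hA hB a b m; case: (split_ordP a) => j ->.
  by rewrite col_mxEu scat_lshift; apply: hA.
by rewrite col_mxEd scat_rshift; apply: hB.
Qed.

Lemma hmx_const p q (s' : 'I_p -> nat) (s : 'I_q -> nat) (A : 'M[R]_(p, q)) a b :
  hmx s' s A -> s' a = s b -> A a b = ((A a b)@_0%MM)%:MP.
Proof.
move=> hA sab; apply/mpolyP=> m; rewrite mcoeffC.
have [->|m0] := eqVneq m 0%MM; first by rewrite mulr1.
rewrite mulr0; apply/memN_msupp_eq0/negP=> /hA.
by rewrite sab -[RHS]add0n => /addIn/eqP; rewrite mdeg_eq0 (negPf m0).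
Qed.

Lemma hmx_unit p q (s' : 'I_p -> nat) (s : 'I_q -> nat) (A : 'M[R]_(p, q)) a b :
  hmx s' s A -> (A a b)@_0%MM != 0 -> s' a = s b.
Proof. by move=> hA; rewrite -mcoeff_msupp => /hA; rewrite mdeg0. Qed.

(* The homogeneous component of degree [d]. *)
Definition hc q (s : 'I_q -> nat) d (v : 'rV[R]_q) : 'rV[R]_q :=
  \row_j mres (fun m => (mdeg m + s j == d)%N) (v 0 j).

Lemma hc_hmx q (s : 'I_q -> nat) d v : hmx (fun=> d) s (hc s d v).
Proof. by move=> a b m; rewrite mxE msupp_mres => /andP[/eqP]. Qed.

Lemma hc_id q (s : 'I_q -> nat) d v : hmx (fun=> d) s v -> hc s d v = v.
Proof.
move=> hv; apply/rowP=> j; rewrite mxE; apply: mres_id => m /hv.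
by move=> /eqP.
Qed.

Lemma hcM p q (s' : 'I_p -> nat) (s : 'I_q -> nat) (D : 'M[R]_(p, q)) d v :
  hmx s' s D -> hc s d (v *m D) = hc s' d v *m D.
Proof.
move=> hD; apply/rowP=> j; rewrite !mxE mres_sum; apply: eq_bigr => i _.
rewrite mxE; apply: mresM => m1 m2 /hD <-; by rewrite mdegD addnA.
Qed.

Lemma hc0 q (s : 'I_q -> nat) d : hc s d 0 = 0.
Proof. by apply/rowP=> j; rewrite !mxE mres0. Qed.

Lemma hc_row q1 q2 (s1 : 'I_q1 -> nat) (s2 : 'I_q2 -> nat) d u v :
  hc (scat s1 s2) d (row_mx u v) = row_mx (hc s1 d u) (hc s2 d v).
Proof.
apply/rowP=> j; rewrite mxE; case: (split_ordP j) => i ->.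
  by rewrite !row_mxEl mxE scat_lshift.
by rewrite !row_mxEr mxE scat_rshift.
Qed.

(** * Graded submodules, generators and syzygies *)

Definition gsub q (s : 'I_q -> nat) (N : 'rV[R]_q -> Prop) : Prop :=
  [/\ N 0, forall u v, N u -> N v -> N (u + v),
      forall c u, N u -> N (c *: u) & forall d u, N u -> N (hc s d u)].

Definition generates p q (D : 'M[R]_(p, q)) (N : 'rV[R]_q -> Prop) : Prop :=
  forall v, N v <-> exists w : 'rV_p, v = w *m D.

Definition syz p q (D : 'M[R]_(p, q)) : 'rV[R]_p -> Prop :=
  fun v => v *m D = 0.

Lemma gsub_syz p q (s' : 'I_p -> nat) (s : 'I_q -> nat) (D : 'M[R]_(p, q)) :
  hmx s' s D -> gsub s' (syz D).
Proof.
move=> hD; rewrite /syz; split=> [|u v Nu Nv|c u Nu|d u Nu].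
- by rewrite mul0mx.
- by rewrite mulmxDl Nu Nv addr0.
- by rewrite -scalemxAl Nu scaler0.
- by rewrite -(hcM _ _ hD) Nu hc0.
Qed.

Lemma gsub_sum q (s : 'I_q -> nat) N I (r : seq I) (F : I -> 'rV[R]_q) :
  gsub s N -> (forall i, N (F i)) -> N (\sum_(i <- r) F i).
Proof. by case=> N0 ND _ _ NF; elim/big_ind: _. Qed.

Lemma gsub_mul p q (s : 'I_q -> nat) N (D : 'M[R]_(p, q)) w :
  gsub s N -> (forall i, N (row i D)) -> N (w *m D).
Proof.
move=> gN ND; rewrite mulmx_sum_row; apply: (gsub_sum _ gN) => i.
by case: gN => _ _ + _; apply.
Qed.

(** The rows of [V] are homogeneous and [D] commutes with taking components, so any preimage of a
    row may be replaced by its component of the right degree. *)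
Lemma hmx_lift r p q (sV : 'I_r -> nat) (s' : 'I_p -> nat) (s : 'I_q -> nat)
    (D : 'M[R]_(p, q)) (V : 'M[R]_(r, q)) :
  hmx s' s D -> hmx sV s V -> (forall i, exists w, row i V = w *m D) ->
  exists2 W, hmx sV s' W & V = W *m D.
Proof.
move=> hD hV VD.
have /fin_all_exists2[f hf fD] : forall i,
    exists2 w : 'rV_p, hmx (fun=> sV i) s' w & row i V = w *m D.
  move=> i; have [w wD] := VD i; exists (hc s' (sV i) w); first exact: hc_hmx.
  rewrite -(hcM _ _ hD) -wD hc_id // => a b m; rewrite mxE; exact: hV.
exists (\matrix_i f i) => [a b m|]; first by rewrite mxE; apply: hf.
by apply/row_matrixP=> i; rewrite row_mul rowK.
Qed.

(* A free resolution of [N] of length at most [l], with generators of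
    degree at most [t + i] in step [i]. *)
Fixpoint bres l t q (s : 'I_q -> nat) (N : 'rV[R]_q -> Prop) : Prop :=
  if l is l'.+1 then
    exists p (s' : 'I_p -> nat) (D : 'M[R]_(p, q)),
      [/\ hmx s' s D, forall a, (s' a <= t)%N, generates D N &
          bres l' t.+1 s' (syz D)]
  else forall v, N v <-> v = 0.

Lemma bres_ext l t q (s : 'I_q -> nat) (N N' : 'rV[R]_q -> Prop) :
  (forall v, N v <-> N' v) -> bres l t s N -> bres l t s N'.
Proof.
move=> NN'; case: l => [h v|l [p [s' [D [hD ht gD hl]]]]] /=.
  by rewrite -NN'; apply: h.
by exists p, s', D; split=> // v; rewrite -NN'; apply: gD.
Qed.

Lemma bresS l t q (s : 'I_q -> nat) (N : 'rV[R]_q -> Prop) :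
  bres l t s N -> bres l.+1 t s N.
Proof.
elim: l t q s N => [|l IH] t q s N.
  move=> N0; exists 0%N, (fun=> 0%N), 0; split=> [||v|v].
  - exact: hmx0.
  - by case.
  - by rewrite N0; split=> [->|[w ->]]; rewrite ?mulmx0 //; exists 0; rewrite mulmx0.
  - by split=> _; rewrite ?thinmx0 // /syz mulmx0.
case=> p [s' [D [hD ht gD hl]]]; exists p, s', D; split=> //; exact: IH.
Qed.

Lemma bres_le l l' t q (s : 'I_q -> nat) (N : 'rV[R]_q -> Prop) :
  (l <= l')%N -> bres l t s N -> bres l' t s N.
Proof. by move=> /subnK <-; elim: (_ - _)%N => // k IH /IH /bresS. Qed.

Lemma bres_le_deg l t t' q (s : 'I_q -> nat) (N : 'rV[R]_q -> Prop) :
  (t <= t')%N -> bres l t s N -> bres l t' s N.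
Proof.
elim: l t t' q s N => [//|l IH] t t' q s N tt'.
case=> p [s' [D [hD ht gD hl]]]; exists p, s', D; split=> //.
  by move=> a; apply: leq_trans tt'.
by apply: IH hl.
Qed.

Lemma bres_shift l t q (s : 'I_q -> nat) (N : 'rV[R]_q -> Prop) :
  bres l t s N -> bres l t.+1 (fun j => (s j).+1) N.
Proof.
elim: l t q s N => [//|l IH] t q s N.
case=> p [s' [D [hD ht gD hl]]]; exists p, (fun a => (s' a).+1), D; split=> //.
  by move=> a b m /hD <-; rewrite addnS.
exact: IH.
Qed.

(** [A] maps [N] isomorphically onto [N'], though it may have a kernel on the ambient free module.
    Composing the generators of [N] with [A] leaves their syzygies unchanged. *)
Lemma bres_iso l t q q' (s : 'I_q -> nat) (s' : 'I_q' -> nat)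
    (N : 'rV[R]_q -> Prop) (N' : 'rV[R]_q' -> Prop) (A : 'M[R]_(q, q')) :
  hmx s s' A -> (forall x, N x -> x *m A = 0 -> x = 0) ->
  (forall y, N' y <-> exists2 x, N x & y = x *m A) ->
  bres l t s N -> bres l t s' N'.
Proof.
move=> hA injA NA; case: l => [|l] /=.
  move=> N0 v; rewrite NA; split=> [[x /N0->] ->|->]; first by rewrite mul0mx.
  by exists 0; rewrite ?N0 ?mul0mx.
case=> p [s1 [D [hD ht gD hl]]]; exists p, s1, (D *m A); split=> //.
- exact: hmxM hA.
- move=> v; rewrite NA; split=> [[x /gD[w ->] ->]|[w ->]].
    by exists w; rewrite mulmxA.
  by exists (w *m D); rewrite ?mulmxA //; apply/gD; exists w.
- apply: bres_ext hl => v; rewrite /syz mulmxA; split=> [->|/injA->] //.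
    by rewrite mul0mx.
  by apply/gD; exists v.
Qed.

(** [N] is an extension of its projection [N2] by the kernel [N1]. Generators of [N1] together with
    lifts of generators of [N2] generate [N], and their syzygies are again an extension, of [syz D2]
    by [syz D1]. *)
Lemma bres_horseshoe l t q1 q2 (s1 : 'I_q1 -> nat) (s2 : 'I_q2 -> nat)
    (N : 'rV[R]_(q1 + q2) -> Prop) (N1 : 'rV[R]_q1 -> Prop)
    (N2 : 'rV[R]_q2 -> Prop) :
  gsub (scat s1 s2) N -> (forall u, N1 u <-> N (row_mx u 0)) ->
  (forall v, N2 v <-> exists u, N (row_mx u v)) ->
  bres l t s1 N1 -> bres l t s2 N2 -> bres l t (scat s1 s2) N.
Proof.
elim: l t q1 q2 s1 s2 N N1 N2 => [|l IH] t q1 q2 s1 s2 N N1 N2 gN eN1 eN2.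
  move=> N10 N20 v; split=> [|->]; last by case: gN.
  rewrite -[v]hsubmxK => Nv.
  have v2 : rsubmx v = 0 by apply/N20/eN2; exists (lsubmx v).
  by move: Nv; rewrite v2 -eN1 N10 => ->; rewrite row_mx0.
case=> p1 [s1' [D1 [hD1 ht1 gD1 hl1]]] [p2 [s2' [D2 [hD2 ht2 gD2 hl2]]]].
have [_ ND NZ Nhc] := gN.
have /fin_all_exists2[f hf Nf] : forall i : 'I_p2, exists2 u : 'rV_q1,
    hmx (fun=> s2' i) s1 u & N (row_mx u (row i D2)).
  move=> i; have /eN2[u Nu] : N2 (row i D2).
    by apply/gD2; exists (delta_mx 0 i); rewrite rowE.
  exists (hc s1 (s2' i) u); first exact: hc_hmx.
  have <- : hc s2 (s2' i) (row i D2) = row i D2.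
    by apply: hc_id => a b m; rewrite mxE; apply: hD2.
  by rewrite -hc_row; apply: Nhc.
(* The rows of [X] complete the rows of [D2] to elements of [N]. *)
pose X := \matrix_i f i; pose D := block_mx D1 0 X D2.
have hX : hmx s2' s1 X by move=> a b m; rewrite mxE; apply: hf.
have hD : hmx (scat s1' s2') (scat s1 s2) D.
  by apply: hmx_col; apply: hmx_row => //; apply: hmx0.
have NX w : N (row_mx (w *m X) (w *m D2)).
  rewrite -mul_mx_row; apply: (gsub_mul _ gN) => i.
  by rewrite row_row_mx rowK.
have ND1 w : N (row_mx (w *m D1) 0) by apply/eN1/gD1; exists w.
have mulD u v : row_mx u v *m D = row_mx (u *m D1 + v *m X) (v *m D2).
  by rewrite mul_row_block mulmx0 add0r.
exists (p1 + p2)%N, (scat s1' s2'), D; split=> //.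
- by move=> a; case: (split_ordP a) => j ->; rewrite ?scat_lshift ?scat_rshift.
- move=> v; split=> [|[w ->]]; last first.
    rewrite -[w]hsubmxK mulD -[X in row_mx _ X]add0r -add_row_mx.
    exact: ND.
  rewrite -[v]hsubmxK; set v1 := lsubmx v; set v2 := rsubmx v => Nv.
  have /gD2[w2 e2] : N2 v2 by apply/eN2; exists v1.
  have /gD1[w1 e1] : N1 (v1 - w2 *m X).
    apply/eN1; rewrite -[X in row_mx _ X](subrr v2) -add_row_mx -opp_row_mx.
    by apply: ND => //; rewrite -scaleN1r e2; apply: NZ.
  by exists (row_mx w1 w2); rewrite mulD -e1 -e2 subrK.
- apply: (IH _ _ _ _ _ _ (syz D1) (syz D2)) => //; first exact: gsub_syz hD.
    move=> u; rewrite /syz mulD !mul0mx addr0.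
    split=> [->|]; first by rewrite row_mx0.
    by rewrite -row_mx0 => /eq_row_mx[].
  move=> v; rewrite /syz; split=> [vD2|[u]]; last first.
    by rewrite mulD -row_mx0 => /eq_row_mx[].
  (* A syzygy of [D2] combines the lifts to an element of [N1], which a combination of the rows of
     [D1] cancels. *)
  have /gD1[w e] : N1 (v *m X) by apply/eN1; rewrite -vD2.
  by exists (- w); rewrite mulD mulNmx -e addNr vD2 row_mx0.
Qed.

(** * Cancellation of redundant generators *)

Definition del q (a : 'I_q.+1) : 'M[R]_(q, q.+1) := row' a 1%:M.

(* For [w 0 a = 1]: the projection along [w] onto the vectors vanishing at
   [a].  The lock keeps [mulmxA] from matching inside it. *)
Definition pr q (a : 'I_q.+1) (w : 'rV[R]_q.+1) : 'M[R]_(q.+1, q) :=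
  locked ((1%:M - delta_mx a (0 : 'I_1) *m w) *m (del a)^T).

(** On rows, the transpose of [del a] deletes the entry at [a] and [del a] inserts a zero there, so
    the composition clears that entry. *)
Lemma delTdel q (a : 'I_q.+1) :
  (del a)^T *m del a = 1%:M - delta_mx a (0 : 'I_1) *m delta_mx (0 : 'I_1) a.
Proof.
apply/matrixP=> i j; rewrite mul_delta_mx !mxE.
under eq_bigr => k _ do rewrite !mxE.
case: (unliftP a i) => [i0|] ->.
  rewrite (bigD1 i0) //= eqxx mul1r big1 ?addr0; last first.
    by move=> k ki; rewrite (inj_eq lift_inj) (negPf ki) mul0r.
  by rewrite [lift a i0 == a]eq_sym (negPf (neq_lift _ _)) /= subr0.
rewrite eqxx /= big1; last first.
  by move=> k _; rewrite [_ == a]eq_sym (negPf (neq_lift _ _)) mul0r.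
by rewrite eq_sym subrr.
Qed.

Lemma deldelT q (a : 'I_q.+1) : del a *m (del a)^T = 1%:M.
Proof.
apply/matrixP=> i j; rewrite !mxE (bigD1 (lift a i)) //= !mxE eqxx mul1r.
rewrite big1 ?addr0 => [|k ki]; first by rewrite (inj_eq lift_inj) eq_sym.
by rewrite !mxE eq_sym (negPf ki) mul0r.
Qed.

Lemma del_delta q (a : 'I_q.+1) : del a *m delta_mx a (0 : 'I_1) = 0.
Proof.
apply/matrixP=> i j; rewrite !mxE big1 // => k _; rewrite !mxE.
have [->|_] := eqVneq k a; last by rewrite mulr0.
by rewrite eq_sym (negPf (neq_lift _ _)) mul0r.
Qed.

Lemma mul_delta_col q (a : 'I_q.+1) (w : 'rV[R]_q.+1) :
  w *m delta_mx a (0 : 'I_1) = (w 0 a)%:M.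
Proof. by rewrite -colE; apply/rowP=> i; rewrite !mxE (ord1 i) mulr1n. Qed.

Lemma del_pr q (a : 'I_q.+1) w : del a *m pr a w = 1%:M.
Proof.
by rewrite /pr -lock mulmxA mulmxBr mulmxA del_delta mul0mx subr0 mulmx1 deldelT.
Qed.

Lemma mul_pr_self q (a : 'I_q.+1) (w : 'rV[R]_q.+1) : w 0 a = 1 -> w *m pr a w = 0.
Proof.
move=> wa; rewrite /pr -lock mulmxA mulmxBr mulmxA mul_delta_col wa mulmx1 mul1mx.
by rewrite subrr mul0mx.
Qed.

Lemma mul_pr_del q (a : 'I_q.+1) (w x : 'rV[R]_q.+1) : w 0 a = 1 ->
  x *m pr a w *m del a = x - x 0 a *: w.
Proof.
move=> wa; rewrite /pr -lock -!mulmxA delTdel mulmxBr mulmx1 mulmxBl mul1mx.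
rewrite mulmxA -[_ *m w *m _]mulmxA mul_delta_col wa mulmx1 subrr subr0.
by rewrite mulmxBr mulmx1 mulmxA mul_delta_col mul_scalar_mx.
Qed.

Lemma hmx_del q (s : 'I_q.+1 -> nat) a : hmx (fun j => s (lift a j)) s (del a).
Proof.
by apply: hmx_natr => i j; rewrite !mxE; case: eqP => [->|_]; [right|left].
Qed.

Lemma hmx_pr q (s : 'I_q.+1 -> nat) a (w : 'rV_q.+1) :
  hmx (fun=> s a) s w -> hmx s (fun j => s (lift a j)) (pr a w).
Proof.
move=> hw; rewrite /pr -lock; apply: (@hmxM _ _ _ _ s); last first.
  by apply: hmx_natr => i j; rewrite !mxE; case: eqP => [->|_]; [right|left].
apply: hmxB; first exact: hmx1.
apply: (@hmxM _ _ _ _ (fun=> s a)) => //.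
apply: hmx_natr => i j; rewrite !mxE (ord1 j) eqxx andbT.
by case: eqP => [->|_]; [right|left].
Qed.

(* If [w \in N] has a unit coordinate at [a], then [N] is the direct sum of
   [R w] and the elements of [N] vanishing at [a].  A unit coordinate of a
   lift of [w] to the generators gives a redundant generator, and cancelling
   it leaves the syzygies unchanged up to isomorphism. *)
Lemma bres_cancel l t q (s : 'I_q.+1 -> nat) (N : 'rV[R]_q.+1 -> Prop) w a :
  bres l t s N -> N w -> hmx (fun=> s a) s w -> w 0 a = 1 ->
  bres l t (fun j => s (lift a j)) (fun u => N (u *m del a)).
Proof.
move=> + Nw hw wa; case: l => [h|l].
  by move: Nw wa; rewrite h => ->; rewrite mxE => /eqP; rewrite eq_sym oner_eq0.
case=> p [s' [D [hD ht gD hl]]].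
have [|z hz wz] := hmx_lift hD hw.
  by move=> i; apply/gD; rewrite (ord1 i) row_id.
(* The entry [w 0 a = 1] is a sum of products, one of which has a nonzero constant term; so [z] has
   a unit coefficient at some generator [b]. *)
have [b zb Dba] : exists2 b, (z 0 b)@_0%MM != 0 & (D b a)@_0%MM != 0.
  apply: NNPP => nb; move: wa; rewrite wz mxE => /(congr1 (mcoeff 0%MM)) /eqP.
  rewrite raddf_sum /= mcoeff1 eqxx big1 ?(eq_sym 0) ?oner_eq0 // => b _.
  rewrite mcoeff0M; apply/eqP; rewrite mulf_eq0; apply/negPn/negP.
  by rewrite negb_or => /andP[zb Db]; apply: nb; exists b.
case: p => [|p] in s' D hD ht gD hl z hz wz b zb Dba *; first by case: b zb Dba.
have sb : s a = s' b by exact: hmx_unit hz zb.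
have zbC := hmx_const hz sb; set c := (z 0 b)@_0%MM in zb zbC.
pose z' := (c^-1)%:MP *: z.
have z'b : z' 0 b = 1 by rewrite mxE zbC -mpolyCM mulVf.
have zz' : z = c%:MP *: z' by rewrite scalerA -mpolyCM mulfV // scale1r.
have z'D : z' *m D = (c^-1)%:MP *: w by rewrite -scalemxAl -wz.
have hz' : hmx (fun=> s' b) s' z'.
  by apply: hmxZ; rewrite -sb.
clearbody z'.
have wpr := mul_pr_self wa; have zpr := mul_pr_self z'b.
(* Generator [b] is dropped and the others are projected along [w]. *)
exists p, (fun j => s' (lift b j)), (del b *m D *m pr a w); split=> //.
- by apply: hmxM (hmx_pr hw); apply: hmxM hD; apply: hmx_del.
- move=> u; split=> [/gD[y uy]|[y ->]].
    have eu : u = y *m D *m pr a w by rewrite -uy -mulmxA del_pr mulmx1.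
    exists (y *m pr b z'); rewrite !mulmxA; rewrite mul_pr_del // !mulmxBl -!scalemxAl.
    by rewrite z'D -scalemxAl wpr !scaler0 subr0.
  rewrite !mulmxA mul_pr_del //; apply/gD; set x := _ 0 a.
  by exists (y *m del b - x *: z); rewrite mulmxBl -scalemxAl -wz.
(* Projection along [z'] identifies [syz D] with the new syzygies. It is injective there: [D] sends
   [z'] to a nonzero constant multiple of [w], and [w 0 a = 1], so no nonzero multiple of [z'] is a
   syzygy. *)
- apply: (bres_iso (A := pr b z') (s := s') (N := syz D)) => //.
  + exact: hmx_pr.
  + move=> x xD xpr; have := mul_pr_del x z'b; rewrite xpr mul0mx.
    move=> /esym/eqP; rewrite subr_eq0; set y := x 0 b => /eqP ex; rewrite ex.
    move: xD; rewrite /syz ex -scalemxAl z'D => /rowP/(_ a)/eqP.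
    rewrite !mxE wa mulr1 mulf_eq0 => /orP[/eqP->|]; first by rewrite scale0r.
    by rewrite mpolyC_eq0 invr_eq0 (negPf zb).
  + move=> y; rewrite /syz; split=> [|[x xD ->]].
      rewrite !mulmxA => yD.
      exists (y *m del b - (y *m del b *m D) 0 a *: z).
        by rewrite mulmxBl -scalemxAl -wz -(mul_pr_del _ wa) yD mul0mx.
      rewrite mulmxBl -(mulmxA y _ (pr b z')) del_pr mulmx1 -scalemxAl zz'.
      by rewrite -scalemxAl zpr !scaler0 subr0.
    rewrite !mulmxA mul_pr_del // !mulmxBl -!scalemxAl xD mul0mx.
    by rewrite z'D -scalemxAl wpr !scaler0 subr0.
Qed.

(** * Passage to minimal resolutions *)

Definition in_max_ideal q (N : 'rV[R]_q -> Prop) : Prop :=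
  forall v, N v -> forall j, (v 0 j)@_0%MM = 0.

Fixpoint minres (l t : nat) q (s : 'I_q -> nat) (N : 'rV[R]_q -> Prop) : Prop :=
  if l is l'.+1 then
    in_max_ideal N /\ exists p (s' : 'I_p -> nat) (D : 'M[R]_(p, q)),
      [/\ hmx s' s D, forall a, (s' a <= t)%N, generates D N &
          minres l' t.+1 s' (syz D)]
  else forall v, N v <-> v = 0.

(** Induction on the number of generators: a syzygy with a nonzero constant term makes a generator
    redundant, and [bres_cancel] shows that deleting it keeps the bounds on the syzygies. If there
    is no such syzygy, this step is already minimal. *)
Lemma bres_minres l t q (s : 'I_q -> nat) (N : 'rV[R]_q -> Prop) :
  in_max_ideal N -> bres l t s N -> minres l t s N.
Proof.
elim: l t q s N => [//|l IH] t q s N mN [p [s' [D [hD ht gD hl]]]].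
split=> //; elim: p => [|p IHp] in s' D hD ht gD hl *.
  by exists 0%N, s', D; split=> //; apply: IH => // v _ [].
case: (classic (in_max_ideal (syz D))) => [mD|].
  by exists p.+1, s', D; split=> //; apply: IH.
case/not_all_ex_not=> v nv; have [vD /not_all_ex_not[a /eqP va]] := imply_to_and _ _ nv.
(* The component in degree [s' a] keeps the constant term at [a], and its entry there is constant,
   so it can be scaled to 1. *)
pose w0 := hc s' (s' a) v.
have w0a : (w0 0 a)@_0%MM = (v 0 a)@_0%MM.
  by rewrite mxE mcoeff_mres mdeg0 add0n eqxx.
have hw0 : hmx (fun=> s' a) s' w0 by exact: hc_hmx.
have w0D : w0 *m D = 0 by case: (gsub_syz hD) => _ _ _ /(_ (s' a) v vD).
pose w := (((v 0 a)@_0%MM)^-1)%:MP *: w0.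
have wa : w 0 a = 1.
  by rewrite mxE (hmx_const hw0 (erefl (s' a))) w0a -mpolyCM mulVf.
have hw : hmx (fun=> s' a) s' w by exact: hmxZ.
have wD : w *m D = 0 by rewrite -scalemxAl w0D scaler0.
apply: (IHp (fun j => s' (lift a j)) (del a *m D)) => //.
- by apply: hmxM hD; apply: hmx_del.
- move=> u; rewrite gD; split=> [[y ->]|[y ->]].
    exists (y *m pr a w); rewrite mulmxA mul_pr_del // mulmxBl -scalemxAl wD.
    by rewrite scaler0 subr0.
  by exists (y *m del a); rewrite mulmxA.
- apply: bres_ext (bres_cancel hl wD hw wa) => u.
  by rewrite /syz mulmxA.
Qed.

End BoundedResolutions.

(** * Assembling resolutions into infinite sequences *)

Definition rk_cons (q : nat) (rk : nat -> nat) (i : nat) : nat :=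
  if i is i'.+1 then rk i' else q.

Definition shift_cons q (s : 'I_q -> nat) rk (sh : forall i, 'I_(rk i) -> nat) i :
    'I_(rk_cons q rk i) -> nat :=
  match i with 0 => s | i'.+1 => sh i' end.

Section ResolutionSequence.
Variables (K : fieldType) (n : nat).
Local Notation R := {mpoly K[n]}.

(** Case analysis on the index lets the ranks compute, so consecutive matrices fit without casts. *)
Definition diff_cons p q rk (D : 'M[R]_(p, q))
    (d : forall i, 'M[R]_(rk i, rk_cons p rk i)) i :
    'M[R]_(rk_cons p rk i, rk_cons q (rk_cons p rk) i) :=
  match i with 0 => D | i'.+1 => d i' end.

Lemma minres_seq l t q (s : 'I_q -> nat) (N : 'rV[R]_q -> Prop) :
  minres l t s N ->
  exists rk (sh : forall i, 'I_(rk i) -> nat)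
    (d : forall i, 'M[R]_(rk i, rk_cons q rk i)),
  [/\ forall i, hmx (sh i) (@shift_cons q s rk sh i) (d i),
      forall i a, (sh i a <= t + i)%N, generates (d 0%N) N,
      forall i, generates (d i.+1) (syz (d i)) &
      forall i a b, (d i a b)@_0%MM = 0].
Proof.
elim: l t q s N => [|l IH] t q s N.
  (* Past its end the resolution is continued by modules of rank zero. *)
  move=> N0; exists (fun=> 0%N), (fun=> fun=> 0%N), (fun=> 0); split=> //.
  - by move=> i; apply: hmx0.
  - by move=> v; rewrite N0; split=> [->|[w ->]]; [exists 0|]; rewrite mulmx0.
  - by move=> i v; split=> _; [exists 0|]; rewrite ?thinmx0 // /syz mulmx0.
  - by move=> i [].
case=> mN [p [s' [D [hD ht gD]]]] /IH[rk [sh [d [hd htd gd0 gd d0]]]].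
exists (rk_cons p rk), (@shift_cons p s' rk sh), (diff_cons D d); split=> //.
- by case=> [|i]; [exact: hD | exact: hd].
- by case=> [|i] a; [rewrite addn0; exact: ht | rewrite addnS -addSn; exact: htd].
- by case=> [|i]; [exact: gd0 | exact: gd].
- case=> [|i] a b; last exact: d0.
  have := mN (row a D); rewrite gD => /(_ _ b); rewrite mxE; apply.
  by exists (delta_mx 0 a); rewrite rowE.
Qed.

End ResolutionSequence.

(** * Comparison with pure resolutions *)

Section PureResolutions.
Variables (K : fieldType) (n : nat) (C : {set 'I_n}).
Local Notation R := {mpoly K[n]}.
Local Notation eps := (map_mx (mres (supp_in C))).

Lemma eps_mulmx p q r (A : 'M[R]_(p, q)) (B : 'M[R]_(q, r)) :
  eps (A *m B) = eps A *m eps B.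
Proof.
apply/matrixP=> i j; rewrite !mxE mres_sum; apply: eq_bigr => k _.
by rewrite !mxE mres_supp_inM.
Qed.

Lemma eps0 p q : eps (0 : 'M[R]_(p, q)) = 0.
Proof. by apply/matrixP=> i j; rewrite !mxE mres0. Qed.

Lemma hmx_eps p q (s' : 'I_p -> nat) (s : 'I_q -> nat) (A : 'M[R]_(p, q)) :
  hmx s' s A -> hmx s' s (eps A).
Proof. by move=> hA a b m; rewrite mxE msupp_mres => /andP[_ /hA]. Qed.

(* A free resolution of [N] of length [k] with nonzero last term, all of
    whose maps have quadratic entries in the variables of [C]. *)
Fixpoint pure (k : nat) q (N : 'rV[R]_q -> Prop) : Prop :=
  if k is k'.+1 then
    exists p (D : 'M[R]_(p, q)),
      [/\ forall e, hmx (fun=> e + 2)%N (fun=> e) D, eps D = D,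
          generates D N & pure k' (syz D)]
  else (0 < q)%N /\ forall v, N v <-> v = 0.

Lemma pure_ext k q (N N' : 'rV[R]_q -> Prop) :
  (forall v, N v <-> N' v) -> pure k N -> pure k N'.
Proof.
move=> NN'; case: k => [[q0 h]|k [p [D [hD eD gD hk]]]].
  by split=> // v; rewrite -NN'; apply: h.
by exists p, D; split=> // v; rewrite -NN'; apply: gD.
Qed.

Lemma quad_mcoeff0 p q (D : 'M[R]_(p, q)) a b :
  hmx (fun=> 2) (fun=> 0%N) D -> (D a b)@_0%MM = 0.
Proof.
move=> hD; apply/eqP; apply: contraT; rewrite -mcoeff_msupp => /hD.
by rewrite mdeg0.
Qed.

Lemma pure_in_max_ideal k q (N : 'rV[R]_q -> Prop) : pure k N -> in_max_ideal N.
Proof.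
case: k => [[_ N0] v /N0-> j|k [p [D [hD _ gD _]]] v /gD[w ->] j].
  by rewrite mxE mcoeff0.
rewrite mxE raddf_sum /= big1 // => i _.
by rewrite mcoeff0M (quad_mcoeff0 _ _ (hD 0%N)) mulr0.
Qed.

(* If a pure resolution [T] maps to [F] and [eps F] maps back to [T] so that
   the composition is the identity in one degree, then the same holds in the
   next degree: the composition of the lifts is homogeneous of degree 0, so it
   has constant entries, and no nonzero constant vector is a syzygy of [T]. *)
Lemma pure_shift (F : graded_free_seq K n) k :
  (forall i, hmx (@shift _ _ F i.+1) (@shift _ _ F i) (diff F i)) ->
  (forall i, generates (diff F i.+1) (syz (diff F i))) ->
  forall i q (N : 'rV[R]_q -> Prop) e (f : 'M[R]_(q, rk F i))
    (G : 'M[R]_(rk F i, q)),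
  pure k N -> hmx (fun=> e) (@shift _ _ F i) f ->
  hmx (@shift _ _ F i) (fun=> e) G ->
  (forall v, N v -> exists w, v *m f = w *m diff F i) ->
  (forall w, N (eps (w *m diff F i) *m G)) ->
  eps f *m G = 1%:M ->
  exists j (b : 'I_(rk F j)), j = (i + k)%N /\ shift b = (e + k.*2)%N.
Proof.
move=> hF gF; elim: k => [|k IH] i q N e f G /=.
  move=> [q0 _] hf hG _ _ fG.
  (* As [q] is positive, a diagonal entry 1 of the composition forces a unit entry of [G], hence a
     generator of [F] in degree [e]. *)
  have [b Gb] : exists b, (G b (Ordinal q0))@_0%MM != 0.
    apply: NNPP => nG; move: fG => /matrixP/(_ (Ordinal q0) (Ordinal q0)).
    rewrite !mxE eqxx => /(congr1 (mcoeff 0%MM))/eqP.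
    rewrite raddf_sum /= mcoeff1 eqxx big1 ?(eq_sym 0) ?oner_eq0 // => b _.
    rewrite mcoeff0M; apply/eqP; rewrite mulf_eq0; apply/orP; right.
    by apply: contraT => Gb; case: nG; exists b.
  by exists i, b; rewrite !addn0; split=> //; exact: hmx_unit hG Gb.
case=> p [D [hD eD gD pD]] hf hG Nf NG fG.
have [|f' hf' ef'] := hmx_lift (hF i) (hmxM (hD e) hf).
  move=> a; rewrite row_mul; apply: Nf; apply/gD.
  by exists (delta_mx 0 a); rewrite rowE.
have [|G' hG' eG'] := hmx_lift (hD e) (hmxM (hmx_eps (hF i)) hG).
  move=> b; apply/gD; rewrite rowE mulmxA.
  have -> : delta_mx 0 b *m eps (diff F i) =
      eps ((delta_mx 0 b : 'rV_(rk F i.+1)) *m diff F i).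
    by rewrite -!rowE map_row.
  exact: NG.
have C1 : eps f' *m G' = 1%:M.
  apply/eqP; rewrite -subr_eq0; apply/eqP; set X := _ - _.
  have hX : hmx (fun=> e + 2)%N (fun=> e + 2)%N X.
    by apply: hmxB; [apply: hmxM hG'; apply: hmx_eps | apply: hmx1].
  have XD : X *m D = 0.
    by rewrite mulmxBl mul1mx -mulmxA -eG' mulmxA -eps_mulmx -ef' eps_mulmx eD
      -mulmxA fG mulmx1 subrr.
  apply/matrixP=> a b; rewrite (hmx_const hX) // [RHS]mxE.
  have /(pure_in_max_ideal pD)/(_ b) : syz D (row a X).
    by rewrite /syz -row_mul XD row0.
  by rewrite mxE => ->.
have [||j [b [ej eb]]] := IH i.+1 p (syz D) (e + 2)%N f' G' pD hf' hG' _ _ C1.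
- by move=> v vD; apply/gF; rewrite /syz -mulmxA -ef' mulmxA vD mul0mx.
- move=> w; have /gF : exists w', w *m diff F i.+1 = w' *m diff F i.+1 by exists w.
  rewrite /syz => wd.
  by rewrite -(mulmxA _ G') -eG' mulmxA -eps_mulmx wd eps0 mul0mx.
- by exists j, b; rewrite eb; split; lia.
Qed.

(** * Mapping cones of multiplication by a quadric *)

Definition koszul_syz p q (D : 'M[R]_(p, q)) (g : R) : 'rV[R]_(p + q) -> Prop :=
  fun v => lsubmx v *m D + g *: rsubmx v = 0.

Lemma eps_row p q1 q2 (A : 'M[R]_(p, q1)) (B : 'M[R]_(p, q2)) :
  eps (row_mx A B) = row_mx (eps A) (eps B).
Proof. exact: map_row_mx. Qed.

Lemma mresN P (g : R) : mres P (- g) = - mres P g.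
Proof.
by apply/mpolyP=> m; rewrite mcoeffN !mcoeff_mres mcoeffN; case: ifP; rewrite ?oppr0.
Qed.

Lemma eps_scalar q (g : R) : mres (supp_in C) g = g -> eps (g%:M : 'M_q) = g%:M.
Proof.
move=> eg; apply/matrixP=> i j; rewrite !mxE.
by case: (i == j); rewrite ?mulr1n ?mulr0n ?mres0.
Qed.

Lemma hmx_scalar q (g : R) d : {in msupp g, forall m, mdeg m = d} ->
  forall e, hmx (fun=> e + d)%N (fun=> e) (g%:M : 'M_q).
Proof.
move=> hg e i j m; rewrite mxE; case: (i == j); rewrite ?msupp0 // mulr1n.
by move/hg=> ->; rewrite addnC.
Qed.

Lemma scale_mpolymx_eq0 p q (g : R) (A : 'M[R]_(p, q)) :
  g != 0 -> g *: A = 0 -> A = 0.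
Proof.
move=> g0 /matrixP gA; apply/matrixP=> i j; have /eqP := gA i j.
by rewrite !mxE mulf_eq0 (negPf g0) => /eqP.
Qed.

(** [koszul_syz D g] is the syzygy module of the rows of [D] together with [g] times the basis
    vectors. Since [g] is regular modulo the rows of [D], a mapping cone resolves it; the next step
    has the same shape, with [E] for [D] and [- g] for [g]. *)
Lemma pure_koszul k p q (D : 'M[R]_(p, q)) (g : R) :
  g != 0 -> {in msupp g, forall m, mdeg m = 2} -> mres (supp_in C) g = g ->
  (forall e, hmx (fun=> e + 2)%N (fun=> e) D) -> eps D = D ->
  (forall c : 'rV_q, (exists w, g *: c = w *m D) -> exists w, c = w *m D) ->
  pure k (syz D) -> pure k.+1 (koszul_syz D g).
Proof.
elim: k p q D g => [|k IH] p q D g g0 hg eg hD eD reg.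
  (* Here [D] has no syzygies: if [y D + g c = 0], regularity gives [c = w D], and then
     [y = - g w]. *)
  case=> p0 D0; exists p, (row_mx (- g)%:M D); split.
  - move=> e a b m; case: (split_ordP b) => j ->; last by rewrite row_mxEr; apply: hD.
    rewrite row_mxEl; apply: hmx_scalar => m'; rewrite (perm_mem (msuppN g)); exact: hg.
  - by rewrite eps_row eD eps_scalar ?mresN ?eg.
  - move=> v; rewrite /koszul_syz; split=> [|[w ->]]; last first.
      rewrite mul_mx_row row_mxKl row_mxKr mul_mx_scalar -scalemxAl scaleNr.
      by rewrite addNr.
    set y := lsubmx v; set c := rsubmx v => /eqP.
    rewrite addrC addr_eq0 -mulNmx => /eqP gc.
    have [w ew] := reg c (ex_intro _ _ gc); exists w.
    have : syz D (y + g *: w).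
      by rewrite /syz mulmxDl -scalemxAl -ew gc mulNmx addrN.
    rewrite D0 => /eqP; rewrite addr_eq0 -scaleNr => /eqP yw.
    by rewrite mul_mx_row mul_mx_scalar -ew -yw hsubmxK.
  - split=> // v; rewrite /syz mul_mx_row mul_mx_scalar; split=> [|->]; last first.
      by rewrite scaler0 mul0mx row_mx0.
    by rewrite -row_mx0 => /eq_row_mx[+ _]; apply: scale_mpolymx_eq0; rewrite oppr_eq0.
case=> p2 [E [hE eE gE pE]].
have hgN : {in msupp (- g), forall m, mdeg m = 2}.
  by move=> m'; rewrite (perm_mem (msuppN g)); exact: hg.
have egN : mres (supp_in C) (- g) = - g by rewrite mresN eg.
have gN0 : - g != 0 by rewrite oppr_eq0.
exists (p2 + p)%N, (block_mx E 0 (- g)%:M D); split.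
- move=> e a b m; case: (split_ordP a) => i ->; case: (split_ordP b) => j ->.
  + by rewrite block_mxEul; apply: hE.
  + by rewrite block_mxEur mxE msupp0.
  + by rewrite block_mxEdl; apply: hmx_scalar.
  + by rewrite block_mxEdr; apply: hD.
- by rewrite map_block_mx eD eE eps0 eps_scalar.
- move=> v; rewrite /koszul_syz; split=> [|[w ->]]; last first.
    rewrite -[w]hsubmxK mul_row_block mulmx0 add0r row_mxKl row_mxKr.
    rewrite mulmxDl mul_mx_scalar -scalemxAl scaleNr addrNK.
    by apply/gE; exists (lsubmx w).
  set y := lsubmx v; set c := rsubmx v => /eqP.
  rewrite addrC addr_eq0 -mulNmx => /eqP gc.
  have [w ew] := reg c (ex_intro _ _ gc).
  have /gE[z yw] : syz D (y + g *: w).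
    by rewrite /syz mulmxDl -scalemxAl -ew gc mulNmx addrN.
  exists (row_mx z w); rewrite mul_row_block mulmx0 add0r mul_mx_scalar -ew.
  by rewrite -yw scaleNr addrK hsubmxK.
- apply: pure_ext (IH p2 p E (- g) gN0 hgN egN hE eE _ pE).
    move=> v; rewrite /koszul_syz /syz -{3}[v]hsubmxK mul_row_block mulmx0 add0r.
    rewrite mul_mx_scalar; set y := lsubmx v; set c := rsubmx v.
    split=> [yc|]; last by rewrite -row_mx0 => /eq_row_mx[].
    (* After multiplication by [g] the second condition follows from the first, because the rows of
       [E] are syzygies of [D]. *)
    rewrite yc; suff -> : c *m D = 0 by rewrite row_mx0.
    apply: (scale_mpolymx_eq0 gN0); rewrite scalemxAl.
    move: yc => /eqP; rewrite addrC addr_eq0 -mulNmx => /eqP->.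
    by apply/gE; exists (- y).
  (* [g] is regular modulo the rows of [E]: these span the syzygies of [D], and the polynomial ring
     is a domain. *)
  move=> c gc; apply/gE; apply: (scale_mpolymx_eq0 gN0).
  by rewrite scalemxAl; apply/gE.
Qed.

End PureResolutions.

(** * Monomial ideals as submodules of the free module of rank one *)

Section MonomialIdeals.
Variables (K : fieldType) (n : nat).
Local Notation R := {mpoly K[n]}.
Implicit Types (A B : pred 'X_{1..n}) (x : 'I_n).

Definition midl A : 'rV[R]_1 -> Prop := fun v => mono A (v 0 0).

Local Notation s0 := (fun=> 0%N : nat).

Lemma mnm1_le x m : (U_(x) <= m)%MM = (0 < m x)%N.
Proof.
apply/mnm_lepP/idP => [/(_ x)|mx i]; rewrite mnm1E ?eqxx //.
by case: (x =P i) => [<-|].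
Qed.

Lemma eq_row1 (u v : 'rV[R]_1) : u 0 0 = v 0 0 -> u = v.
Proof. by move=> uv; apply/rowP=> i; rewrite (ord1 i). Qed.

Lemma midl_pred0 v : midl pred0 v <-> v = 0.
Proof.
split=> [v0|->]; last by rewrite /midl mxE; apply: mono0.
apply: eq_row1; rewrite mxE; apply/eqP; rewrite -msupp_eq0.
by case E: (msupp _) => [//|m r]; have := v0 m; rewrite E inE eqxx => /(_ isT).
Qed.

Lemma row2E (u v : 'rV[R]_1) :
  (row_mx u v 0 (lshift 1 0) = u 0 0) * (row_mx u v 0 (rshift 1 0) = v 0 0).
Proof. by rewrite row_mxEl row_mxEr. Qed.

(* [R/I] is generated by the classes of [x] and [1]; the syzygies of these two
   generators are an extension of [(I, x)] by [(I : x)] and split as [I + R]. *)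
Lemma bres_colon l t A B x : up_closed A ->
  (forall m, B m = A m || (0 < m x)%N) ->
  bres l t s0 (midl (fun m => A (m + U_(x))%MM)) -> bres l t.+1 s0 (midl B) ->
  bres l t.+1 s0 (midl A).
Proof.
move=> upA BA /bres_shift hC hB.
have {}BA m : B m = A m || (U_(x) <= m)%MM by rewrite BA mnm1_le.
(* The generators [x] and 1 have degrees 1 and 0; [Z] is their module of syzygies modulo the
   ideal. *)
pose s1 : 'I_1 -> nat := fun=> 1%N; pose s2 : 'I_1 -> nat := fun=> 0%N.
pose val2 (v : 'rV[R]_(1 + 1)) := v 0 (lshift 1 0) * 'X_x + v 0 (rshift 1 0).
pose Z v := mono A (val2 v).
have val2_row u v : val2 (row_mx u v) = u 0 0 * 'X_x + v 0 0.
  by rewrite /val2 !row2E.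
have gZ : gsub (scat s1 s2) Z.
  split=> [|u v Zu Zv|c u Zu|d u Zu]; rewrite /Z /val2.
  - by rewrite !mxE mul0r addr0; apply: mono0.
  - by rewrite !mxE mulrDl addrACA; apply: monoD.
  - by rewrite !mxE -mulrA -mulrDr; apply: monoM.
  - rewrite !mxE -(@mresM _ _ (fun m => (mdeg m == d)%N)); last first.
      move=> m1 m2; rewrite msuppX inE => /eqP->.
      by rewrite mdegD mdeg1 scat_lshift.
    have -> : mres (fun m => (mdeg m + scat s1 s2 (rshift 1 ord0) == d)%N)
        (u 0 (rshift 1 0)) = mres (fun m => mdeg m == d) (u 0 (rshift 1 0)).
      by apply/mpolyP=> m; rewrite !mcoeff_mres scat_rshift addn0.
    by rewrite -mresD; apply: mono_mres.
have hZ : bres l t.+1 (scat s1 s2) Z.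
  (* The syzygies with second entry zero give the colon ideal, shifted by the degree of [x]; the
     second entries of all syzygies give the ideal enlarged by [x]. *)
  apply: bres_horseshoe gZ _ _ hC hB => [u|v].
    by rewrite /Z val2_row [(0 : 'rV_1) 0 0]mxE addr0 monoMX.
  rewrite /midl (mono_colon _ upA BA); split=> [[c Ac]|[u Zu]].
    exists (- c)%:M; rewrite /Z val2_row mxE eqxx mulr1n mulNr addrC; exact: Ac.
  exists (- u 0 0); rewrite mulNr opprK addrC.
  by move: Zu; rewrite /Z val2_row.
pose a : 'I_2 := @lshift 1 1 ord0.
(* The relation [(1, - x)] has a unit entry. Cancelling it leaves the syzygies with first entry
   zero, which are the ideal itself. *)
pose w : 'rV[R]_2 := @row_mx R 1 1 1 1%:M (- 'X_x)%:M.
have hw : hmx (fun=> scat s1 s2 a) (scat s1 s2) w.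
  rewrite /a scat_lshift; apply: hmx_row => i j m; rewrite mxE (ord1 i) (ord1 j) mulr1n.
    by rewrite msupp1 inE => /eqP->; rewrite mdeg0.
  by rewrite (perm_mem (msuppN _)) msuppX inE => /eqP->; rewrite mdeg1.
have wa : w 0 a = 1 by rewrite /w /a row2E mxE.
have Zw : Z w by rewrite /Z val2_row !mxE !mulr1n mul1r addrN; apply: mono0.
have := bres_cancel hZ Zw hw wa.
have lift1 (j : 'I_1) : lift a j = rshift 1 j by apply/val_inj.
apply: (bres_iso (A := 1%:M)).
- by apply: hmx_natr => i j; right; rewrite mxE lift1 scat_rshift (ord1 i) (ord1 j).
- by move=> v; rewrite mulmx1.
- have Zdel (v : 'rV_1) : Z (v *m del K n a) <-> midl A v.
    suff e : val2 (v *m del K n a) = v 0 0 by rewrite /Z e.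
    rewrite /val2 !mxE !big_ord1 !mxE -!lift1.
    rewrite -/a [lift a 0 == a]eq_sym (negPf (neq_lift _ _)) eqxx.
    rewrite mulr0 mul0r add0r mulr1.
    by congr (v _ _); apply/val_inj.
  move=> y; split=> [Ay|[v + ->]]; last by rewrite Zdel mulmx1.
  by exists y; rewrite ?mulmx1 // Zdel.
Qed.

(** [x] is regular modulo the ideal, which therefore equals its colon by [x]. The syzygies of the
    enlarged set of generators extend a copy of the ideal, shifted by one degree, by the old
    syzygies; hence [t] does not grow. *)
Lemma bres_variable l t A B x : up_closed A -> (0 < t)%N ->
  (forall m, A (m + U_(x))%MM = A m) ->
  (forall m, B m = A m || (0 < m x)%N) ->
  bres l t s0 (midl A) -> bres l.+2 t s0 (midl B).
Proof.
move=> upA t0 regA BA hA.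
have {}BA m : B m = A m || (U_(x) <= m)%MM by rewrite BA mnm1_le.
have hA1 := bres_shift (bresS hA).
case/bresS: hA => p [s' [D [hD ht gD hl]]].
pose X : 'M[R]_1 := ('X_x)%:M.
have hX : hmx (fun=> 1%N) s0 X.
  move=> i j m; rewrite mxE (ord1 i) (ord1 j) mulr1n msuppX inE => /eqP->.
  by rewrite mdeg1.
exists (p + 1)%N, (scat s' (fun=> 1%N)), (col_mx D X); split.
- exact: hmx_col.
- by move=> a; case: (split_ordP a) => j ->; rewrite ?scat_lshift ?scat_rshift.
- move=> v; rewrite /midl (mono_colon _ upA BA); split=> [[c Ac]|[w ->]].
    have /gD[w ew] : midl A (v - c *: X) by rewrite /midl !mxE mulr1n.
    exists (row_mx w c%:M); rewrite mul_row_col -ew mul_scalar_mx subrK.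
    by [].
  exists (w 0 (rshift p 0)); rewrite -[w]hsubmxK mul_row_col row_mxEr.
  have : midl A (lsubmx w *m D) by apply/gD; exists (lsubmx w).
  congr mono; rewrite !mxE big_ord1 !mxE mulr1n addrK.
  by [].
- apply: (bres_horseshoe (N1 := syz D) (N2 := midl A) _ _ _ (bresS hl) hA1).
  + by apply: (gsub_syz (s := s0)); apply: hmx_col.
  + by move=> u; rewrite /syz mul_row_col mul0mx addr0.
  + move=> v; transitivity (midl A (v *m X)).
      rewrite /midl mxE big_ord1 mxE mulr1n monoMX /mono.
      by split=> h m /h; rewrite regA.
    rewrite gD /syz; split=> [[w ew]|[u]].
      by exists (- w); rewrite mul_row_col ew mulNmx addNr.
    rewrite mul_row_col addrC => /eqP; rewrite addr_eq0 -mulNmx => /eqP.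
    by exists (- u).
Qed.

Lemma bres_variables (r : seq 'I_n) : uniq r ->
  exists l, bres l 1 s0 (midl (fun m => has (fun x => (0 < m x)%N) r)).
Proof.
elim: r => [_|x r IH /= /andP[xr /IH[l hl]]].
  by exists 0%N; apply: midl_pred0.
exists l.+2; apply: (bres_variable (x := x)) hl => // [m1 m2|m|m].
- move=> /hasP[y yr my]; apply/hasP; exists y => //.
  by rewrite mnmDE addn_gt0 my.
- apply: eq_in_has => y yr; rewrite mnmDE mnm1E.
  by case: eqP xr => [->|_]; rewrite ?yr ?addn0.
- by rewrite orbC.
Qed.

(** * Koszul resolutions of matchings *)

Definition edge_at (e : 'I_n * 'I_n) : pred 'X_{1..n} :=
  fun m => (0 < m e.1)%N && (0 < m e.2)%N.

Definition ends (T : Type) (r : seq (T * T)) : seq T :=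
  flatten [seq [:: e.1; e.2] | e <- r].

(** The ends are distinct, so the quadric of each edge is regular modulo the ideal of the edges
    after it; every edge contributes one mapping cone. *)
Lemma pure_edges (C : {set 'I_n}) (r : seq ('I_n * 'I_n)) :
  uniq (ends r) -> {subset ends r <= C} ->
  pure C (size r) (midl (fun m => has (edge_at^~ m) r)).
Proof.
elim: r => [_ _|[a b] r IH].
  by split=> //; apply: midl_pred0.
rewrite /ends /= -/(ends r) inE !negb_or => /and3P[/andP[ab ar] br ur] sC.
have aC : a \in C by apply: sC; rewrite !inE eqxx.
have bC : b \in C by apply: sC; rewrite !inE eqxx orbT.
have {}IH : pure C (size r) (midl (fun m => has (edge_at^~ m) r)).
  by apply: IH => // x xr; apply: sC; rewrite !inE xr !orbT.
set A := fun m => has _ r in IH *.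
have upA : up_closed A.
  move=> m1 m2 /hasP[e er /andP[h1 h2]]; apply/hasP; exists e => //.
  by rewrite /edge_at !mnmDE !addn_gt0 h1 h2.
pose q := (U_(a) + U_(b))%MM.
have regA m : A (m + q)%MM = A m.
  apply: eq_in_has => e er; rewrite /edge_at !mnmDE !mnm1E.
  have er1 : e.1 \in ends r by apply/flatten_mapP; exists e => //; rewrite !inE eqxx.
  have er2 : e.2 \in ends r.
    by apply/flatten_mapP; exists e => //; rewrite !inE eqxx orbT.
  have neq x y : x \notin ends r -> y \in ends r -> (x == y) = false.
    by move=> xr yr; apply/eqP=> xy; rewrite xy yr in xr.
  by rewrite !neq // !addn0.
pose B (m : 'X_{1..n}) := ((0 < m a) && (0 < m b))%N || A m.
have BA m : B m = A m || (q <= m)%MM.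
  rewrite /B orbC; congr (_ || _); apply/andP/mnm_lepP => [[ma mb] i|h].
    rewrite mnmDE !mnm1E; have [<-|_] := eqVneq a i; last by case: (b =P i) => [<-|].
    by rewrite eq_sym (negPf ab).
  by split; [have := h a|have := h b]; rewrite mnmDE !mnm1E eqxx; apply: leq_trans;
    rewrite ?leq_addl ?leq_addr.
pose g : R := 'X_[q].
have g0 : g != 0 by rewrite -msupp_eq0 msuppX.
have hg : {in msupp g, forall m, mdeg m = 2}.
  by move=> m; rewrite msuppX inE => /eqP->; rewrite mdegD !mdeg1.
have eg : mres (supp_in C) g = g.
  apply: mres_id => m; rewrite msuppX inE => /eqP->; rewrite supp_inD.
  by apply/andP; split; apply/forallP=> i; apply/implyP; rewrite mnm1E;
    apply: contraNT; case: (_ =P i) => [<-|].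
apply: (@pure_ext _ _ _ (size r).+1 _ (midl B)) => //.
have gens p (D : 'M[R]_(p, 1)) : generates D (midl A) ->
    generates (col_mx D g%:M) (midl B).
  move=> gD v; rewrite /midl (mono_colon _ upA BA); split=> [[c Ac]|[w ->]].
    have /gD[w ew] : midl A (v - c *: g%:M) by rewrite /midl !mxE mulr1n.
    exists (row_mx w c%:M); rewrite mul_row_col -ew mul_scalar_mx subrK.
    by [].
  exists (w 0 (rshift p 0)); rewrite -[w]hsubmxK mul_row_col row_mxEr.
  have : midl A (lsubmx w *m D) by apply/gD; exists (lsubmx w).
  congr mono; rewrite !mxE big_ord1 !mxE mulr1n addrK.
  by [].
(* [pure] of length zero supplies no matrix, so the last edge of the list is added to an empty
   matrix of generators. *)
case Er : (size r) IH => [|k] IH.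
  have g0D : generates (0 : 'M[R]_(0, 1)) (midl A).
    move=> v; case: IH => _ ->; split=> [->|[w ->]]; last by rewrite mulmx0.
    by exists 0; rewrite mulmx0.
  have hg2 e : hmx (fun=> e + 2)%N (fun=> e) (g%:M : 'M[R]_1) by apply: hmx_scalar.
  rewrite /=; exists 1%N, g%:M; split=> //; first by rewrite eps_scalar.
    move=> v; rewrite (gens _ _ g0D v); split=> [[w ->]|[w ->]].
      by exists (rsubmx w); rewrite -[w in LHS]hsubmxK mul_row_col mulmx0 add0r.
    by exists (row_mx 0 w); rewrite mul_row_col mulmx0 add0r.
  split=> // v; rewrite /syz mul_mx_scalar; split=> [|->]; last by rewrite scaler0.
  exact: scale_mpolymx_eq0.
case: IH => p [D [hD eD gD pD]].
rewrite /=; exists (p + 1)%N, (col_mx D g%:M); split.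
- move=> e i j m; case: (split_ordP i) => i' ->; rewrite ?col_mxEu ?col_mxEd.
    exact: hD.
  exact: hmx_scalar.
- by rewrite map_col_mx eD eps_scalar.
- exact: gens.
- apply: pure_ext (pure_koszul g0 hg eg hD eD _ pD) => [v|c].
    by rewrite /koszul_syz /syz -{3}[v]hsubmxK mul_row_col mul_mx_scalar.
  rewrite -gD -(gD c) /midl mxE mulrC monoMX /mono => h m /h.
  by rewrite regA.
Qed.

End MonomialIdeals.

(** Minimising the bounded resolution gives the upper bound; the ideal is resolved from homological
    degree 1 on, hence [r.+1]. [A'] agrees with [A] on the monomials in the variables of [C], and
    its pure resolution gives the lower bound. *)
Lemma is_reg_mono (K : fieldType) n (I : {mpoly K[n]} -> Prop)
    (A A' : pred 'X_{1..n}) (C : {set 'I_n}) l r :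
  (forall f, I f <-> mono A f) -> ~~ A 0%MM ->
  bres l r.+1 (fun=> 0%N) (@midl K n A) -> pure C r (@midl K n A') ->
  (forall m, A' m -> A m) -> (forall m, supp_in C m -> A m -> A' m) ->
  is_reg I r%:Z.
Proof.
move=> IA A0 hA pA' A'A AA'.
have [rk [sh [d [hd ht gd0 gd d0]]]] : exists rk (sh : forall i, 'I_(rk i) -> nat)
    (d : forall i, 'M[{mpoly K[n]}]_(rk i, rk_cons 1 rk i)),
  [/\ forall i, hmx (sh i) (@shift_cons 1 (fun=> 0%N) rk sh i) (d i),
      forall i a, (sh i a <= r.+1 + i)%N, generates (d 0%N) (midl A),
      forall i, generates (d i.+1) (syz (d i)) &
      forall i a b, (d i a b)@_0%MM = 0].
  apply: (@minres_seq _ _ l); apply: bres_minres hA => v Av j.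
  rewrite (ord1 j); apply: memN_msupp_eq0; apply: contra A0; exact: Av.
pose F := @GradedFreeSeq K n (rk_cons 1 rk) (@shift_cons 1 (fun=> 0%N) rk sh) d 1%:M.
(* The comparison starts from the identity of the free module of rank one in degree zero. *)
have [] := @pure_shift _ _ C F r hd gd 0%N 1%N _ 0%N 1%:M 1%:M pA'.
- by move=> i j m; rewrite (ord1 i) (ord1 j) mxE msupp1 inE => /eqP->; rewrite mdeg0.
- by move=> i j m; rewrite (ord1 i) (ord1 j) mxE msupp1 inE => /eqP->; rewrite mdeg0.
- by move=> v Av; apply/gd0; rewrite mulmx1 => m /Av /A'A.
- move=> w; rewrite mulmx1 /midl mxE => m; rewrite msupp_mres => /andP[mC mw].
  apply: AA' => //; have /gd0 : exists w', w *m d 0%N = w' *m d 0%N by exists w.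
  exact.
- apply/matrixP=> i j; rewrite mulmx1 !mxE; case: (i == j); rewrite ?mres0 //.
  by apply: mres_id => m; rewrite msupp1 inE => /eqP->; apply: supp_in0.
move=> j [b [ej eb]]; exists F; split; first split; first split.
- move=> a; rewrite mxE (ord1 a) eqxx; apply/dhomogP => m.
  by rewrite msupp1 inE => /eqP->; apply: mdeg0.
- exact: hd.
- split.
  + move=> f; exists f%:M; apply/IA; rewrite mulmx1 mxE mulr1n subrr; exact: mono0.
  + by move=> v; rewrite mulmx1 IA; apply: gd0.
  + exact: gd.
- exact: d0.
- exists j, (r.*2); split; last by rewrite ej; lia.
  by rewrite -lt0n; apply/card_gt0P; exists b; rewrite inE eb.
(* Degrees in homological degree [i] are at most [r + i]; for [i = 0] the only generator has degree
   zero. *)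
move=> i k; rewrite -lt0n => /card_gt0P[a]; rewrite inE => /eqP <-.
by case: i a => [|i] a //=; have := ht i a; lia.
Qed.

(** * Edge ideals *)

Section EdgeIdeals.
Variables (K : fieldType) (H : sgraph).
Local Notation R := {mpoly K[#|H|]}.

Definition edge_mon : pred 'X_{1..#|H|} := fun m : 'X_{1..#|H|} =>
  [exists u : H, exists v : H,
     sedge u v && ((0 < m (enum_rank u)) && (0 < m (enum_rank v)))%N].

Lemma edge_monP (m : 'X_{1..#|H|}) :
  reflect (exists u v : H, [/\ sedge u v, 0 < m (enum_rank u) & 0 < m (enum_rank v)]%N)
    (edge_mon m).
Proof.
apply: (iffP existsP) => [[u /existsP[v /and3P[]]]|[u [v [e mu mv]]]].
  by exists u, v.
by exists u; apply/existsP; exists v; rewrite e mu mv.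
Qed.

Lemma edge_idealP (f : R) : edge_ideal f <-> mono edge_mon f.
Proof.
split=> [[c ->]|ef].
  apply: big_ind => [||u _]; [exact: mono0 | exact: monoD |].
  apply: big_ind => [||v uv]; [exact: mono0 | exact: monoD |].
  rewrite -mpolyXD => m; rewrite (perm_mem (msuppMX _ _)) => /mapP[m' _ ->].
  apply/edge_monP; exists u, v.
  by split; rewrite // !mnmDE !mnm1E eqxx ?addnA ?addn_gt0 ?orbT.
rewrite [f]mpolyE big_seq; apply: big_ind => [|g h [c ->] [c' ->]|m mf].
- exists (fun _ _ => 0); rewrite big1 // => u _; rewrite big1 // => v _; exact: mul0r.
- exists (fun u v => c u v + c' u v); rewrite -big_split; apply: eq_bigr => u _.
  by rewrite -big_split; apply: eq_bigr => v _; rewrite /= mulrDl.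
have /edge_monP[u [v [uv mu mv]]] := ef m mf.
pose q := (U_(enum_rank u) + U_(enum_rank v))%MM.
have uv_neq : enum_rank u != enum_rank v.
  by apply: contraTneq uv => /enum_rank_inj->; rewrite sedge_irr.
have qm : (q <= m)%MM.
  apply/mnm_lepP=> i; rewrite mnmDE !mnm1E.
  have [<-|_] := eqVneq (enum_rank u) i; last by case: (_ =P i) => [<-|].
  by rewrite eq_sym (negPf uv_neq).
(* The sum runs over ordered pairs, so the whole term is assigned to a single orientation of the
   edge. *)
exists (fun u' v' => if (u' == u) && (v' == v) then f@_m *: 'X_[m - q] else 0).
rewrite (bigD1 u) //= [X in _ + X]big1 ?addr0; last first.
  by move=> u' /negPf u'u; rewrite big1 // => v' _; rewrite u'u mul0r.
rewrite (bigD1 v) //= [X in _ + X]big1 ?addr0; last first.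
  by move=> v' /andP[_ /negPf v'v]; rewrite v'v andbF mul0r.
by rewrite !eqxx /= -mpolyXD -scalerAl -mpolyXD submK.
Qed.

(* The monomials of the ideal generated by the edges of [H] and the
    variables in [S]. *)
Definition edge_var_mon (S : {set H}) : pred 'X_{1..#|H|} := fun m : 'X_{1..#|H|} =>
  [exists u : H, (u \in S) && (0 < m (enum_rank u))%N] || edge_mon m.

Lemma edge_var_monP (S : {set H}) (m : 'X_{1..#|H|}) :
  reflect ((exists2 u : H, u \in S & 0 < m (enum_rank u)) \/
     exists u v : H, [/\ sedge u v, 0 < m (enum_rank u) & 0 < m (enum_rank v)])%N
    (edge_var_mon S m).
Proof.
apply: (iffP orP) => -[h|/edge_monP h]; [left|by right|left|right] => //.
  by case/existsP: h => u /andP[]; exists u.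
by case: h => u uS mu; apply/existsP; exists u; rewrite uS.
Qed.

Lemma edge_var_mon_up S : up_closed (edge_var_mon S).
Proof.
move=> m1 m2 /edge_var_monP[[u uS mu]|[u [v [e mu mv]]]]; apply/edge_var_monP.
  by left; exists u; rewrite // mnmDE addn_gt0 mu.
by right; exists u, v; rewrite !mnmDE !addn_gt0 mu mv.
Qed.

Lemma edge_var_monU S (v : H) (m : 'X_{1..#|H|}) :
  edge_var_mon (v |: S) m = edge_var_mon S m || (0 < m (enum_rank v))%N.
Proof.
apply/edge_var_monP/orP => [[[u]|h]|[/edge_var_monP[[u uS mu]|h]|mv]].
- rewrite !inE => /orP[/eqP->|uS] mu; [by right|left].
  by apply/edge_var_monP; left; exists u.
- by left; apply/edge_var_monP; right.
- by left; exists u; rewrite // !inE uS orbT.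
- by right.
- by left; exists v; rewrite // !inE eqxx.
Qed.

(** Dividing by [v] turns the edges at [v] into variables; [v \notin S] prevents the colon from
    becoming the unit ideal. *)
Lemma edge_var_mon_colon (S : {set H}) (v : H) (m : 'X_{1..#|H|}) : v \notin S ->
  edge_var_mon (S :|: [set u | sedge v u]) m
    = edge_var_mon S (m + U_(enum_rank v))%MM.
Proof.
have mU u : (m + U_(enum_rank v))%MM (enum_rank u) = (m (enum_rank u) + (v == u))%N.
  by rewrite mnmDE mnm1E (inj_eq enum_rank_inj).
move=> vS; apply/edge_var_monP/edge_var_monP => [[[u]|h]|[[u uS]|[u [w [e]]]]].
- rewrite !inE => /orP[uS|vu] mu; first by left; exists u; rewrite // mU addn_gt0 mu.
  by right; exists v, u; rewrite !mU eqxx !addn_gt0 mu orbT.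
- by right; case: h => u [w [e mu mw]]; exists u, w; rewrite !mU !addn_gt0 mu mw.
- rewrite mU; case: eqP => [vu|_]; first by rewrite vu uS in vS.
  by rewrite addn0 => mu; left; exists u; rewrite // !inE uS.
- rewrite !mU; case: eqP e => [<-|_] e.
    case: eqP e => [<-|_] e; first by rewrite sedge_irr in e.
    by rewrite addn0 => _ mw; left; exists w; rewrite // !inE e orbT.
  case: eqP e => [<-|_] e; rewrite !addn0 => mu mw; last by right; exists u, w.
  by left; exists u; rewrite // !inE sedge_sym e orbT.
Qed.

(** Every edge is a multiple of a variable from [S], so variables alone generate the ideal. *)
Lemma bres_edgeless (S : {set H}) :
  (forall u v : H, sedge u v -> (u \in S) || (v \in S)) ->
  exists l, bres l 1 (fun=> 0%N) (@midl K _ (edge_var_mon S)).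
Proof.
move=> hS; pose r := [seq enum_rank u | u <- enum S].
have [|l hl] := @bres_variables K _ r.
  by rewrite map_inj_uniq ?enum_uniq //; apply: enum_rank_inj.
exists l; apply: bres_ext hl => w; split=> h m /h => [/hasP[x]|].
  case/mapP=> u; rewrite mem_enum => uS -> mu.
  by apply/edge_var_monP; left; exists u.
have mem u : u \in S -> (0 < m (enum_rank u))%N -> has (fun x => (0 < m x)%N) r.
  by move=> uS mu; apply/hasP; exists (enum_rank u); rewrite ?map_f ?mem_enum.
case/edge_var_monP=> [[u]|[u [v [/hS/orP[uS|vS] mu mv]]]]; first exact: mem.
  exact: mem uS mu.
exact: mem vS mv.
Qed.

(** The neighbours of [x] other than [v] are neighbours of [v], so neither end of the new edge is
    joined to a vertex covered by [M]. *)
Lemma induced_matchingU1 (M : {set {set H}}) (v x : H) :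
  induced_matching M -> sedge v x ->
  (forall y, sedge v y -> y \notin cover M) ->
  (forall y, sedge x y -> y = v \/ sedge v y) ->
  induced_matching ([set v; x] |: M) /\ #|[set v; x] |: M| = #|M|.+1.
Proof.
move=> /and3P[ME MT MI] vx nv nx.
have xM : x \notin cover M by apply: nv.
(* In an edge of [M] at [v] the other end would be a covered neighbour of [v]. *)
have vM : v \notin cover M.
  apply/negP=> /bigcupP[e eM]; have := subsetP ME _ eM.
  rewrite inE => /existsP[a /existsP[b /andP[ab /eqP eab]]].
  have cab z : z \in e -> z \in cover M by move=> ze; apply/bigcupP; exists e.
  rewrite eab !inE => /orP[/eqP va|/eqP vb].
    by move: (nv b); rewrite va ab cab ?eab ?inE ?eqxx ?orbT // => /(_ isT).
  by move: (nv a); rewrite vb sedge_sym ab cab ?eab ?inE ?eqxx // => /(_ isT).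
have vxM : [set v; x] \notin M.
  apply/negP=> h; case/negP: vM; apply/bigcupP; exists [set v; x] => //.
  by rewrite !inE eqxx.
split; last by rewrite cardsU1 vxM.
apply/and3P; split.
- rewrite subUset ME andbT sub1set inE; apply/existsP; exists v.
  by apply/existsP; exists x; rewrite vx eqxx.
- apply/trivIsetP=> A B; rewrite !inE.
  have dis E : E \in M -> [disjoint [set v; x] & E].
    move=> EM; rewrite -setI_eq0; apply/eqP/setP=> z; rewrite !inE.
    apply/negbTE/negP=> /andP[zvx zE].
    have zM : z \in cover M by apply/bigcupP; exists E.
    by case/orP: zvx => /eqP zz; rewrite zz in zM; rewrite zM in vM xM.
  case/orP=> [/eqP->|AM] /orP[/eqP->|BM]; rewrite ?eqxx // => AB.
  + exact: dis.
  + by rewrite disjoint_sym; apply: dis.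
  + by move/trivIsetP: MT; apply.
- apply/subsetP=> e; rewrite inE => /andP[].
  rewrite inE => /existsP[a /existsP[b /andP[ab /eqP ->]]].
  have cov : cover ([set v; x] |: M) = [set v; x] :|: cover M.
    by rewrite /cover bigcup_setU big_set1.
  rewrite cov subUset !sub1set => /andP[].
  have nvM y : sedge v y -> y \in cover M -> false by move=> /nv/negP.
  have nxM y : sedge x y -> y \in cover M -> false.
    by move=> /nx[->|/nvM]; [move/negP: vM|].
  have only w z : (w == v) || (w == x) -> sedge w z ->
      [|| z == v, z == x | z \in cover M] -> [set w; z] = [set v; x].
    case/orP=> /eqP-> wz /or3P[/eqP zz|/eqP zz|zM]; rewrite ?zz // in wz *.
    - by rewrite sedge_irr in wz.
    - by case: (nvM _ wz zM).
    - by rewrite setUC.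
    - by rewrite sedge_irr in wz.
    - by case: (nxM _ wz zM).
  rewrite !in_setU !in_set1 -!orbA => aV bV.
  have [avx|] := boolP ((a == v) || (a == x)); first by rewrite (only a b) ?eqxx.
  have [bvx _|] := boolP ((b == v) || (b == x)).
    by rewrite setUC (only b a) ?eqxx // sedge_sym.
  rewrite !negb_or => /andP[/negPf bv /negPf bx] /andP[/negPf av /negPf ax].
  apply/orP; right; apply: (subsetP MI); rewrite inE.
  move: aV bV; rewrite av ax bv bx /= => aM bM.
  rewrite subUset !sub1set aM bM inE !andbT; apply/existsP; exists a.
  by apply/existsP; exists b; rewrite ab eqxx.
Qed.

End EdgeIdeals.

(** * Induced matchings and whiskers *)

(** Orders the ends of each edge, because [pure_edges] works along a list of ordered pairs. *)
Lemma matching_list (H : sgraph) (s : seq {set H}) :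
  {subset s <= edges H} -> uniq s ->
  {in s &, forall A B : {set H}, A != B -> [disjoint A & B]} ->
  exists2 r : seq (H * H), s = [seq [set p.1; p.2] | p <- r] & uniq (ends r).
Proof.
elim: s => [_ _ _|A s IH sE /= /andP[As us] dis]; first by exists [::].
have [|||r es ur] := IH => //.
- by move=> B Bs; apply: sE; rewrite inE Bs orbT.
- by move=> B B' Bs Bs'; apply: dis; rewrite inE ?Bs ?Bs' orbT.
have := sE A (mem_head _ _); rewrite inE => /existsP[a /existsP[b /andP[ab /eqP eA]]].
have nr z : z \in A -> z \notin ends r.
  move=> zA; apply/negP=> /flatten_mapP[p pr]; rewrite !inE => zp.
  have Bs : [set p.1; p.2] \in s.
    by rewrite es; apply: (map_f (fun p : H * H => [set p.1; p.2])).
  have AB : A != [set p.1; p.2] by apply: contraNneq As => ->.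
  have := dis _ _ (mem_head _ _) _ AB; rewrite inE Bs orbT => /(_ isT).
  by move=> /disjointFr/(_ zA); rewrite !inE zp.
exists ((a, b) :: r); first by rewrite /= -es -eA.
rewrite /ends /= -/(ends r) inE negb_or ur andbT !nr ?eA ?inE ?eqxx ?orbT // !andbT.
by apply: contraTneq ab => ->; rewrite sedge_irr.
Qed.

Lemma induced_matching0 (H : sgraph) : induced_matching (set0 : {set {set H}}).
Proof.
apply/and3P; split; first exact: sub0set.
  by apply/trivIsetP=> A B; rewrite inE.
apply/subsetP=> e; rewrite inE /cover big_set0 => /andP[].
rewrite inE => /existsP[a /existsP[b /andP[_ /eqP->]]].
by rewrite subUset sub1set inE.
Qed.

Lemma im_witness (H : sgraph) :
  exists2 M : {set {set H}}, induced_matching M & #|M| = im H.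
Proof.
have [|M iM eM] := @eq_bigmax_cond _ (@induced_matching H) (fun M => #|M|).
  by apply/card_gt0P; exists set0; apply: induced_matching0.
by exists M => //; rewrite -eM; apply: eq_bigl.
Qed.

Lemma edge_clique_partition_cover (G : sgraph) (Pi : {set {set G}}) (u v : G) :
  edge_clique_partition Pi -> sedge u v ->
  exists W : {W : {set G} | W \in Pi}, (u \in val W) && (v \in val W).
Proof.
case=> _ /and3P[/eqP cPi _ _] uv.
have : [set u; v] \in edges G.
  by rewrite inE; apply/existsP; exists u; apply/existsP; exists v; rewrite uv eqxx.
rewrite -cPi => /bigcupP[E /imsetP[W WPi ->]]; rewrite inE => /andP[_].
by rewrite subUset !sub1set => h; exists (exist _ W WPi).
Qed.

(** * Upper bound for whiskers by vertex removal *)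

Section WhiskerBound.
Variables (K : fieldType) (G : sgraph) (Pi : {set {set G}}).
Local Notation H := (whisker Pi).
Local Notation v_ u := (inl u : H).
Local Notation x_ W := (inr W : H).

(* This property of the whole of [H] passes to [H - v] and [H - N[v]] for any
   vertex [v] of [G]. *)
Definition whiskered (S : {set H}) : Prop :=
  forall u w : G, sedge u w -> v_ u \notin S -> v_ w \notin S ->
  exists W : {W : {set G} | W \in Pi}, [&& u \in val W, w \in val W & x_ W \notin S].

Lemma whisker_nbr (u : G) (W : {W : {set G} | W \in Pi}) (y : H) :
  clique (val W) -> u \in val W -> sedge (x_ W) y -> y = v_ u \/ sedge (v_ u) y.
Proof.
move=> cW; case: y => [w|//] uW wW; have [->|uw] := eqVneq w u; [by left|right].
by apply: cW; rewrite // eq_sym.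
Qed.

(** New vertices are pairwise nonadjacent, so an edge outside [S] either is a whisker or joins two
    old vertices, where [whiskered] applies. *)
Lemma whisker_vertex (S : {set H}) : whiskered S ->
  (exists y z : H, [/\ sedge y z, y \notin S & z \notin S]) ->
  exists u W, [/\ v_ u \notin S, x_ W \notin S & u \in val W].
Proof.
move=> wS [[u|W] [[w|W'] [e yS zS]]].
- by have [W /and3P[uW _ WS]] := wS u w e yS zS; exists u, W.
- by exists u, W'.
- by exists w, W.
- by [].
Qed.

(** Induction on the number of vertices outside [S]. The colon by a vertex adds its neighbours to
    [S] and lowers [r] by one; adjoining the vertex as a generator adds it to [S]. *)
Lemma whisker_bres (S : {set H}) r :
  (forall W, W \in Pi -> clique W) -> whiskered S ->
  (forall M, induced_matching M -> [disjoint cover M & S] -> #|M| <= r)%N ->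
  exists l, bres l r.+1 (fun=> 0%N) (@midl K _ (edge_var_mon S)).
Proof.
move=> Pi_clique; have [k] := ubnP #|~: S|.
elim: k => // k IH in S r *; rewrite ltnS => Sk wS hr.
case: (classic (exists y z : H, [/\ sedge y z, y \notin S & z \notin S])); last first.
  move=> nS; have [|l hl] := @bres_edgeless K H S.
    move=> y z yz; apply: contraT; rewrite negb_or => /andP[yS zS].
    by case: nS; exists y, z.
  by exists l; apply: bres_le_deg hl.
move=> /(whisker_vertex wS)[u [W [uS WS uW]]].
have smaller (S' : {set H}) : S \subset S' -> (exists2 y, y \in S' & y \notin S) ->
    (#|~: S'| < k)%N.
  move=> SS' [y yS' yS]; apply: leq_trans Sk; apply: proper_card.
  rewrite properE setCS SS' /=; apply/subsetPn; exists y; rewrite ?inE ?yS //.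
  by rewrite negbK.
pose N := [set y : H | sedge (v_ u) y].
(* A matching avoiding [S] and the neighbours of [u] still avoids [S] after the edge from [u] to the
   new vertex of [W] is added. *)
have hU (M : {set {set H}}) : induced_matching M ->
    [disjoint cover M & S :|: N] -> (#|M| < r)%N.
  move=> iM; rewrite disjoint_sym => /disjointFr dM.
  have [|||iM' <-] := @induced_matchingU1 H M (v_ u) (x_ W) iM.
  - exact: uW.
  - by move=> y uy; rewrite dM // !inE uy orbT.
  - by move=> y; apply: whisker_nbr => //; apply/Pi_clique/valP.
  apply: hr => //; rewrite disjoint_sym; apply/pred0P=> z /=.
  apply/negbTE/negP=> /andP[zS].
  rewrite /cover bigcup_setU big_set1 !inE => /orP[/orP[]/eqP zz|zM].
  - by rewrite zz (negPf uS) in zS.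
  - by rewrite zz (negPf WS) in zS.
  - by rewrite dM ?inE ?zS in zM.
(* The value zero is impossible: by [hU] the empty matching would have size less than zero. *)
case: r => [|r] in hr hU *.
  have := hU set0 (induced_matching0 H); rewrite /cover big_set0 ltn0 => /(_ _)/notF[].
  by apply/pred0P=> z /=; rewrite inE.
have [|||l1 hl1] := IH (S :|: N) r.
- apply: smaller; first exact: subsetUl.
  by exists (x_ W); rewrite // !inE /= uW orbT.
- move=> u1 w1 e; rewrite !inE !negb_or => /andP[u1S nu1] /andP[w1S nw1].
  have [W1 /and3P[u1W w1W W1S]] := wS u1 w1 e u1S w1S.
  (* If the new vertex of [W1] were adjacent to [u], then [u] would lie in the clique [W1], so [u1]
     or [w1] would be a removed neighbour of [u]. *)
  exists W1; rewrite u1W w1W !inE negb_or W1S /=; apply/negP=> uW1.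
  have [uu1|uu1] := eqVneq u u1; first by rewrite uu1 /= e in nw1.
  by rewrite /= (Pi_clique _ (valP W1) _ _ uW1 u1W uu1) in nu1.
- by move=> M iM dM; rewrite -ltnS; apply: hU.
have [|||l2 hl2] := IH (v_ u |: S) r.+1.
- by apply: smaller; [exact: subsetUr | exists (v_ u); rewrite // !inE eqxx].
- move=> u1 w1 e; rewrite !inE !negb_or => /andP[_ u1S] /andP[_ w1S].
  by have [W1 h] := wS u1 w1 e u1S w1S; exists W1; rewrite !inE.
- move=> M iM dM; apply: hr => //; apply: disjointWr dM; exact: subsetUr.
exists (maxn l1 l2); apply: (@bres_colon _ _ _ _ _ _ (enum_rank (v_ u))).
- exact: edge_var_mon_up.
- move=> m; exact: edge_var_monU.
- apply: bres_le (leq_maxl _ _) (bres_ext _ hl1) => v.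
  by rewrite /midl /mono; split=> h m /h; rewrite edge_var_mon_colon.
- exact: bres_le (leq_maxr _ _) hl2.
Qed.
End WhiskerBound.

(** An edge whose ends are both covered by the induced matching [M] belongs to [M]. Thus setting the
    uncovered variables to zero turns the edge ideal into that of [M]. *)
Lemma edge_mon_pure (K : fieldType) (H : sgraph) (M : {set {set H}}) :
  induced_matching M ->
  exists (A : pred 'X_{1..#|H|}) (C : {set 'I_#|H|}),
  [/\ pure C #|M| (@midl K _ A), forall m, A m -> edge_mon m &
      forall m, supp_in C m -> edge_mon m -> A m].
Proof.
move=> /and3P[/subsetP ME /trivIsetP MT /subsetP MI].
have [|||r er ur] := @matching_list H (enum M).
- by move=> e; rewrite mem_enum => /ME.
- exact: enum_uniq.
- by move=> A B; rewrite !mem_enum; apply: MT.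
have pM p : p \in r -> [set p.1; p.2] \in M.
  by move=> pr; rewrite -mem_enum er; apply: (map_f (fun p : H * H => [set p.1; p.2])).
pose r' := [seq (enum_rank p.1, enum_rank p.2) | p <- r].
have er' : ends r' = [seq enum_rank u | u <- ends r].
  by rewrite /ends; elim: (r) @r' => //= p r0 ->.
exists (fun m : 'X_{1..#|H|} => has (fun e => edge_at e m) r').
exists [set enum_rank u | u in cover M]; split.
- have <- : size r' = #|M| by rewrite size_map cardE er size_map.
  apply: pure_edges; rewrite er'.
    by rewrite map_inj_uniq //; apply: enum_rank_inj.
  move=> _ /mapP[u /flatten_mapP[p pr up] ->]; apply: imset_f.
  by apply/bigcupP; exists [set p.1; p.2]; [exact: pM | rewrite !inE in up *].
- move=> m /hasP[_ /mapP[p pr ->] /andP[/= m1 m2]]; apply/edge_monP.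
  have := ME _ (pM p pr); rewrite inE => /existsP[a /existsP[b /andP[ab /eqP eab]]].
  have me z : z \in [set p.1; p.2] -> (0 < m (enum_rank z))%N.
    by rewrite !inE => /orP[]/eqP->.
  by exists a, b; rewrite ab !me // eab !inE eqxx ?orbT.
- move=> m mC /edge_monP[u [v [uv mu mv]]].
  have cM z : (0 < m (enum_rank z))%N -> z \in cover M.
    move=> mz; move/forallP/(_ (enum_rank z)): mC; rewrite implybE negbK.
    by rewrite eqn0Ngt mz orbF => /imsetP[z' z'M /enum_rank_inj->].
  have : [set u; v] \in M.
    apply: MI; rewrite inE subUset !sub1set !cM // !andbT inE.
    by apply/existsP; exists u; apply/existsP; exists v; rewrite uv eqxx.
  rewrite -mem_enum er => /mapP[p pr euv]; apply/hasP.
  exists (enum_rank p.1, enum_rank p.2); first by apply/mapP; exists p.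
  have me z : z \in [set u; v] -> (0 < m (enum_rank z))%N.
    by rewrite !inE => /orP[]/eqP->.
  by rewrite /edge_at /= !me // euv !inE eqxx ?orbT.
Qed.

(** * Equality of regularity and induced matching number *)

Theorem corollary37 (K : fieldType) (G : sgraph)
  (G_connected : connected G) (G_edge : edges G != set0)
  (C4_free : graph_free (cycle_graph 4) G)
  (C5_free : graph_free (cycle_graph 5) G)
  (Pi : {set {set G}}) (Pi_partition : edge_clique_partition Pi) :
  graph_reg K (whisker Pi) (Posz (im (whisker Pi))).
Proof.
have Pi_clique W : W \in Pi -> clique W by case: Pi_partition => + _ => /(_ W) h /h[].
have [M iM cM] := im_witness (whisker Pi).
have [A [C [pA A_edge edge_A]]] := @edge_mon_pure K _ M iM.
(* For empty [S], [whiskered] says that every edge lies in a clique of [Pi], and the bound on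
   matchings is the definition of [im]. *)
have [||l hl] := @whisker_bres K G Pi set0 (im (whisker Pi)) Pi_clique.
- move=> u w uw _ _.
  have [W /andP[uW wW]] := edge_clique_partition_cover Pi_partition uw.
  by exists W; rewrite uW wW inE.
- by move=> M' iM' _; apply: leq_bigmax_cond.
rewrite cM in pA; apply: (is_reg_mono (A := @edge_mon _) (l := l)) pA A_edge edge_A.
- exact: edge_idealP.
- by apply/edge_monP=> -[u [v []]]; rewrite mnmE.
- apply: bres_ext hl => v; rewrite /midl /mono; split=> h m /h.
    by case/edge_var_monP=> [[u]|h']; [rewrite inE | apply/edge_monP].
  by move=> /edge_monP h'; apply/edge_var_monP; right.
Qed.
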